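(* Let $\eta\in[0,1]$ and let $\psi:\mathbb{Z}^n\times\mathcal{S}^{n-1}\to\mathbb{R}$ be given by $\psi(b,t)=|b|^2+\eta(b\cdot t)^2$. For $n\le9$ its $\mathcal{H}^1$-elliptic envelope $\bar\psi$ obeys, for all $b\in\mathbb{Z}^n$ and $t\in\mathcal{S}^{n-1}$, $$\bar\psi(b,t)\ge\min\Big\{\sum_{\alpha\in\{-1,0,1\}^n}\psi_{\rm e}(\alpha,T_\alpha):\ T=(T_\alpha)_\alpha\in\mathbb{R}^{n3^n},\ \sum_{\alpha\in\{-1,0,1\}^n}\alpha\otimes T_\alpha=b\otimes t\Big\},$$ where $T_\alpha\in\mathbb{R}^n$ and $\psi_{\rm e}$ denotes the positively one-homogeneous extension of $\psi$, $\psi_{\rm e}(b,t)=|t|\,\psi(b,t/|t|)$ for $t\in\mathbb{R}^n$. For $n\ge10$ the same inequality holds with $T\in\mathbb{R}^{n(4n+1)^n}$ and both sums running over all $\alpha\in[-2n,2n]^n\cap\mathbb{Z}^n$.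
   Context: For $\Omega\subset\mathbb{R}^n$ open, $\mathcal{M}_{\rm df}^{(n)}(\Omega)$ is the set of finite $\mathbb{R}^{n\times n}$-valued Radon measures on $\Omega$ of the form $\mu=\theta\otimes\tau\,\mathcal{H}^1\llcorner\gamma$, where $\gamma\subset\Omega$ is $1$-rectifiable, $\tau:\gamma\to\mathcal{S}^{n-1}$ is its unit tangent vector, $\theta:\gamma\to\mathbb{Z}^n$ is $\mathcal{H}^1$-integrable, and $\mu$ is divergence-free, i.e. $\sum_{j=1}^n\int_\Omega\partial_j\varphi\,d\mu_{ij}=0$ for all $\varphi\in C_c^\infty(\Omega)$ and $i=1,\dots,n$. The $\mathcal{H}^1$-elliptic envelope of $\psi$ is, for $b\in\mathbb{Z}^n$, $t\in\mathcal{S}^{n-1}$, $$\bar\psi(b,t)=\inf\Big\{\int_\gamma\psi(\theta,\tau)\,d\mathcal{H}^1:\ \mu=\theta\otimes\tau\,\mathcal{H}^1\llcorner\gamma\in\mathcal{M}_{\rm df}^{(n)}(B_{1/2}),\ \mathrm{supp}\big(\mu-b\otimes t\,\mathcal{H}^1\llcorner(\mathbb{R}t\cap B_{1/2})\big)\subset B_{1/2}\Big\},$$ where $B_{1/2}\subset\mathbb{R}^n$ is the ball of radius $1/2$ centered at $0$; the support condition means that there is a ball $B'\subset\subset B_{1/2}$ with $\mu=b\otimes t\,\mathcal{H}^1\llcorner\mathbb{R}t$ on $B_{1/2}\setminus B'$. By convention $\psi_{\rm e}(b,0)=0$. *)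

(* Defs.v *)
From HB Require Import structures.
From mathcomp Require Import all_boot all_order all_algebra.
From mathcomp Require Import all_classical all_reals all_analysis.

Set Implicit Arguments.
Unset Strict Implicit.
Unset Printing Implicit Defensive.
Import Order.TTheory GRing.Theory Num.Theory.
Import numFieldNormedType.Exports.

Local Open Scope classical_set_scope.
Local Open Scope ring_scope.

(** Euclidean structure of R^n. The norm `|x| provided by the library on
    'rV[R]_n is the sup norm: it induces the right topology and notion of
    derivative, but not the right lengths. *)
Section euclidean.
Context {R : realType} {n : nat}.
Implicit Types (x y c : 'rV[R]_n) (r : R).

Definition dotp x y : R := \sum_(i < n) x 0 i * y 0 i.
Definition enorm x : R := Num.sqrt (dotp x x).
Definition tens x y : 'M[R]_n := x^T *m y.
Definition line x : set 'rV[R]_n := [set s *: x | s in [set: R]].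
Definition eball c r : set 'rV[R]_n := [set x | enorm (x - c) < r].
Definition closed_eball c r : set 'rV[R]_n := [set x | enorm (x - c) <= r].

Definition intv (b : 'rV[int]_n) : 'rV[R]_n := map_mx intr b.

End euclidean.

(** One-dimensional Hausdorff measure, for the Euclidean distance. The
    normalization constant is 1 in dimension 1. *)
Section hausdorff1.
Context {R : realType} {n : nat}.
Implicit Types (A : set 'rV[R]_n) (U : (set 'rV[R]_n)^nat) (d : R).
Local Open Scope ereal_scope.

(* 0 is added so that the diameter of the empty set is 0, not -oo. *)
Definition ediam A : \bar R :=
  ereal_sup (0 |` [set (enorm (x - y))%:E | x in A & y in A]).

Definition hausdorff1_cover d A : set (set 'rV[R]_n)^nat :=
  [set U | A `<=` \bigcup_k U k /\ forall k, ediam (U k) <= d%:E].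

Definition hausdorff1_pre d A : \bar R :=
  ereal_inf [set \sum_(k <oo) ediam (U k) | U in hausdorff1_cover d A].

Definition hausdorff1 A : \bar R :=
  ereal_sup [set hausdorff1_pre d A | d in [set d | (0 < d)%R]].

Lemma ediam_ge0 A : 0 <= ediam A.
Proof. by apply: ereal_sup_ubound; left. Qed.

Lemma ediam0 : ediam set0 = 0.
Proof.
apply/eqP; rewrite eq_le ediam_ge0 andbT; apply: ge_ereal_sup.
by move=> _ [->//|[x []]].
Qed.

Lemma hausdorff1_pre_ge0 d A : 0 <= hausdorff1_pre d A.
Proof.
apply: le_ereal_inf_tmp => _ [U _ <-].
by apply: nneseries_ge0 => k _ _; exact: ediam_ge0.
Qed.

Lemma hausdorff1_ge0 A : 0 <= hausdorff1 A.
Proof.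
apply: (le_trans (hausdorff1_pre_ge0 1 A)).
by apply: ereal_sup_ubound; exists 1%R => //=.
Qed.

Lemma hausdorff1_set0 : hausdorff1 set0 = 0.
Proof.
apply/eqP; rewrite eq_le hausdorff1_ge0 andbT.
apply: ge_ereal_sup => _ [d /= d0 <-].
apply: ereal_inf_lbound; exists (fun=> set0).
  by split => // k; rewrite ediam0 lee_fin ltW.
by rewrite eseries0// => k _ _; rewrite ediam0.
Qed.

Lemma le_hausdorff1 : {homo hausdorff1 : A B / A `<=` B >-> A <= B}.
Proof.
move=> A B AB; apply: ge_ereal_sup => _ [d /= d0 <-].
apply: (@le_trans _ _ (hausdorff1_pre d B)); last first.
  by apply: ereal_sup_ubound; exists d.
apply: le_ereal_inf_tmp => _ [U [BU Ud] <-].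
by apply: ereal_inf_lbound; exists U => //; split => //; exact: subset_trans BU.
Qed.

Lemma hausdorff1_pre_sigma_subadditive d : sigma_subadditive (hausdorff1_pre d).
Proof.
move=> A; have [[i ioo]|] := pselect (exists i, hausdorff1_pre d (A i) = +oo).
  rewrite (eseries_pinfty _ _ ioo) ?leey// => p _.
  by rewrite -ltNye (lt_le_trans _ (hausdorff1_pre_ge0 _ _)).
rewrite -forallNE => Aoo.
apply/lee_addgt0Pr => e e0.
apply: le_trans (epsilon_trick xpredT _ (ltW e0)); last first.
  by move=> p; exact: hausdorff1_pre_ge0.
have [G PG] : {G : ((set 'rV[R]_n)^nat)^nat & forall p,
    hausdorff1_cover d (A p) (G p) /\
    \sum_(k <oo) ediam (G p k) <=
      hausdorff1_pre d (A p) + (e / (2 ^ p.+1)%:R)%:E}.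
  apply: (@choice _ _ (fun p U => hausdorff1_cover d (A p) U /\
    \sum_(k <oo) ediam (U k) <=
      hausdorff1_pre d (A p) + (e / (2 ^ p.+1)%:R)%:E)) => m.
  have e2 : (0 < e / (2 ^ m.+1)%:R)%R by rewrite divr_gt0// ltr0n expn_gt0.
  have fA : hausdorff1_pre d (A m) \is a fin_num.
    by rewrite ge0_fin_numE ?hausdorff1_pre_ge0// ltey; exact/eqP/Aoo.
  have [_ [U cU <-] /ltW Ue] := lb_ereal_inf_adherent e2 fA.
  by exists U.
have G0 x : 0 <= (ediam \o uncurry G) x by exact: ediam_ge0.
apply: (@le_trans _ _ (\esum_(i in setT) (ediam \o uncurry G) i)).
  apply: ereal_inf_lbound => /=.
  have /card_esym/ppcard_eqP[f] := card_nat2.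
  exists (uncurry G \o f).
    split => [|k]; last by rewrite /=; case: (f k) => a b; exact: (PG a).1.2.
    apply: (@subset_trans _ (\bigcup_n \bigcup_k G n k)) => [t [i _]|].
      by move=> /((PG i).1.1) -[j _ ?]; exists i => //; exists j.
    move=> t [i _ [j _ Bijt]]; exists (f^-1%FUN (i, j)) => //=.
    by rewrite invK ?inE.
  rewrite -(esum_pred_image (ediam \o uncurry G) _ xpredT) ?[fun=> _]set_true//.
  by rewrite image_eq.
rewrite (_ : esum _ _ = \sum_(i <oo) \sum_(j <oo) ediam (G i j)); last first.
  pose J : nat -> set (nat * nat) := fun i => [set (i, j) | j in setT].
  rewrite (_ : setT = \bigcup_k J k); last first.
    by rewrite predeqE => -[a b]; split => // _; exists a => //; exists b.
  rewrite esum_bigcupT /=; last 2 first.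
    - apply/trivIsetP => i j _ _ ij.
      rewrite predeqE => -[p m] /=; split => //= -[] [_] _ [<-{p} _].
      by move=> [m' _] [] /esym/eqP; rewrite (negbTE ij).
    - by move=> /= [p m]; exact: ediam_ge0.
  rewrite -(image_id [set: nat]) -fun_true esum_pred_image//; last first.
    by move=> p _; apply: esum_ge0 => ? _; exact: ediam_ge0.
  apply: eq_eseriesr => /= j _.
  rewrite -(esum_pred_image (ediam \o uncurry G) (pair j) predT)//=; last first.
    by move=> ? ? _ _; exact: (@can_inj _ _ _ snd).
    by move=> ? _; exact: ediam_ge0.
  by congr esum; rewrite predeqE => -[a b]; split; move=> [i _ <-]; exists i.
apply: lee_nneseries => [i _ _|i _]; last exact: (PG i).2.
by apply: nneseries_ge0 => *; exact: ediam_ge0.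
Qed.

Lemma hausdorff1_sigma_subadditive : sigma_subadditive hausdorff1.
Proof.
move=> A; apply: ge_ereal_sup => _ [d /= d0 <-].
apply: (le_trans (hausdorff1_pre_sigma_subadditive d A)).
apply: lee_nneseries => [i _ _|i _]; first exact: hausdorff1_pre_ge0.
by apply: ereal_sup_ubound; exists d.
Qed.

HB.instance Definition _ := isOuterMeasure.Build R 'rV[R]_n hausdorff1
  hausdorff1_set0 hausdorff1_ge0 le_hausdorff1 hausdorff1_sigma_subadditive.

End hausdorff1.

(** The measure H^1 on the sigma-algebra of its Caratheodory-measurable sets. *)
Definition H1_outer (R : realType) (n : nat) :
    {outer_measure set 'rV[R]_n -> \bar R} := @hausdorff1 R n.

Definition H1 (R : realType) (n : nat) :
    {measure set (caratheodory_type (H1_outer R n)) -> \bar R} :=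
  (H1_outer R n : set (caratheodory_type (H1_outer R n)) -> \bar R).

Section rectifiable.
Context {R : realType} {n : nat}.
Local Notation V := 'rV[R]_n.
Local Notation H1 := (@H1 R n).
Implicit Types (E A Omega : set V) (x t : V) (phi : V -> R).

Definition H1_measurable : set (set V) := (H1_outer R n).-cara.-measurable.

Definition borel : set (set V) := <<s [set U : set V | open U] >>.

Definition supp phi : set V := closure [set x | phi x != 0].

Definition iter_partial (s : seq 'I_n) phi : V -> R :=
  foldr (fun j f => 'D_(delta_mx 0 j) f) phi s.

Definition test_function Omega phi : Prop :=
  [/\ forall s x, differentiable (iter_partial s phi) x,
      compact (supp phi) & supp phi `<=` Omega].

Definition lipschitz_curve (f : R -> V) : Prop :=
  exists L : R, forall u v, enorm (f u - f v) <= L * `|u - v|.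

(* Countably H^1-rectifiable; finiteness of H^1(E) is not required. *)
Definition rectifiable1 E : Prop :=
  H1_measurable E /\
  exists2 f : nat -> R -> V, (forall k, lipschitz_curve (f k)) &
    hausdorff1 (E `\` \bigcup_k range (f k)) = 0%E.

(* The line R t is the approximate tangent space of E at x: the blow-ups of
   H^1 restricted to E at x converge vaguely to H^1 restricted to R t. *)
Definition approx_tangent E x t : Prop :=
  forall phi, continuous phi -> compact (supp phi) ->
    r^-1 * (\int[H1]_(y in E) phi (r^-1 *: (y - x))) @[r --> 0^'+] -->
    \int[H1]_(y in line t) phi y.

(* A rectifiable set may fail to have locally finite H^1 measure; tangents are
   then defined through the parts of finite measure. By locality of the
   approximate tangent space it would suffice to consider E itself when
   H^1(E) is finite. *)
Definition unit_tangent E (tau : V -> V) : Prop :=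
  [/\ forall x, E x -> enorm (tau x) = 1,
      forall j, measurable_fun (E : set (caratheodory_type (H1_outer R n)))
                  (fun x => tau x 0 j) &
      forall F, H1_measurable F -> F `<=` E -> (H1 F < +oo)%E ->
        {ae H1, forall x, F x -> approx_tangent F x (tau x)}].

(* The data of theta (x) tau H^1 restricted to gamma; the values of theta and
   tau outside gamma are irrelevant. *)
Record rectdata := RectData {
  carrier : set V ;
  multiplicity : V -> 'rV[int]_n ;
  tangent : V -> V }.
Implicit Type m : rectdata.

Definition density m x : 'M[R]_n :=
  tens (intv (multiplicity m x)) (tangent m x).

Definition rect_measure m A : 'M[R]_n :=
  \matrix_(i, j) \int[H1]_(x in carrier m `&` A) density m x i j.

(* The integral of phi with respect to the (i, j) entry of rect_measure m. *)
Definition rect_integral m i j phi : R :=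
  \int[H1]_(x in carrier m) (phi x * density m x i j).

Definition divergence_free Omega m : Prop :=
  forall phi, test_function Omega phi -> forall i,
    \sum_(j < n) rect_integral m i j ('D_(delta_mx 0 j) phi) = 0.

Definition Mdf Omega : set rectdata :=
  [set m | [/\ carrier m `<=` Omega,
               rectifiable1 (carrier m),
               unit_tangent (carrier m) (tangent m),
               forall i, H1.-integrable (carrier m)
                 (fun x => ((multiplicity m x 0 i)%:~R : R)%:E) &
               divergence_free Omega m]].

Definition straight (b : 'rV[int]_n) t : rectdata :=
  RectData (line t) (fun=> b) (fun=> t).

(* m agrees with the straight line in B_{1/2} outside some ball B' whose closure
   is contained in B_{1/2}. *)
Definition straight_near_boundary b t m : Prop :=
  exists c r, [/\ 0 < r, closed_eball c r `<=` eball 0 2^-1 &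
    forall A, borel A -> A `<=` eball 0 2^-1 `\` eball c r ->
      rect_measure m A = rect_measure (straight b t) A].

Definition line_energy (psi : 'rV[int]_n -> V -> R) m : \bar R :=
  (\int[H1]_(x in carrier m) (psi (multiplicity m x) (tangent m x))%:E)%E.

Definition H1_elliptic_envelope (psi : 'rV[int]_n -> V -> R)
    (b : 'rV[int]_n) t : \bar R :=
  ereal_inf [set line_energy psi m |
    m in Mdf (eball 0 2^-1) `&` straight_near_boundary b t].

End rectifiable.

Section decomposition.
Context {R : realType} {n : nat}.
Local Notation V := 'rV[R]_n.
Implicit Types (psi : 'rV[int]_n -> V -> R) (b : 'rV[int]_n) (t : V).

Definition quadratic_psi (eta : R) b t : R :=
  enorm (intv b) ^+ 2 + eta * dotp (intv b) t ^+ 2.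

(* Equals 0 at t = 0, whatever psi. *)
Definition homogeneous_ext psi b t : R := enorm t * psi b ((enorm t)^-1 *: t).

(* 'rV['I_(k.*2.+1)]_n indexes the integer points of [-k, k]^n. *)
Definition box_point k (a : 'rV['I_(k.*2.+1)]_n) : 'rV[int]_n :=
  \row_i ((a 0 i)%:Z - k%:Z).

Definition decompositions k b t : set ('rV['I_(k.*2.+1)]_n -> V) :=
  [set T | \sum_a tens (intv (box_point a)) (T a) = tens (intv b) t].

Definition decomposition_energy psi k (T : 'rV['I_(k.*2.+1)]_n -> V) : R :=
  \sum_a homogeneous_ext psi (box_point a) (T a).

Definition is_minimum (S : set R) (m : R) : Prop := S m /\ lbound S m.

End decomposition.

Arguments decompositions {R n} k b t.

(* Main.v *)
Require Import Defs.
From mathcomp Require Import all_boot all_order all_algebra.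
From mathcomp Require Import all_classical all_reals all_analysis.
From mathcomp Require Import measurable_realfun.
From mathcomp Require Import zify ring lra.
Import Order.TTheory GRing.Theory Num.Theory.
Import numFieldNormedType.Exports.
Set Implicit Arguments.
Unset Strict Implicit.
Unset Printing Implicit Defensive.
Local Open Scope classical_set_scope.
Local Open Scope ring_scope.

(** Two vectors [a], [c] with [3 (a.c) >= |a||c|] satisfy
    [psi (a + c) t >= psi a t + psi c t] for every unit [t] and [eta <= 1]. For
    [n <= 9] one may split off the sign vector of [b], whose norm is at most 3;
    in general one may halve [b] up to rounding as long as it has an entry
    beyond [2n]. By induction every [b] is a sum of box points [a] with
    multiplicities [c_a(b)], independent of [t], of no larger total energy.

    Testing the divergence constraint with [x_k] times a cutoff shows that a
    competitor has total mass [b (x) t]; this uses that Borel sets are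
    H^1-measurable and that H^1 on a line is the Lebesgue measure. Hence the
    integrals [T_a] of [c_a(theta) tau] form an admissible decomposition of
    [b (x) t], and Jensen's inequality for the convex one-homogeneous functions
    [psi_e(a, .)] bounds its energy by that of the competitor. *)

(** * Euclidean inner product and splitting of integer vectors *)

(** The multiplicities must not depend on [t], because [tau] varies along a competitor: with
    coefficients [c_a(theta)] the integrand of [T_a] is linear in [tau], and summing [a (x) T_a]
    under the integral returns the total mass. The splitting criterion is therefore one that serves
    all unit [t] at once.

    The boundary condition equates two matrix-valued set functions with signed entries on Borel
    sets, whereas the divergence constraint speaks of integrals of derivatives. The bridge: if [phi]
    equals [x_k] on the inner ball, then [d_j phi - delta_jk] vanishes there, so its level sets away
    from the value 0 lie where the two measures agree. On the straight line there remains [b_i]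
    times the integral of [D_t phi - t_k] over [[-1/2, 1/2]], which is [- b_i t_k] since [phi]
    vanishes at both ends.

    The box point 0 carries no energy, so the energy controls neither [c_0(theta)] nor [T_0]. The
    former is kept at 0 throughout, the latter is replaced by 0 when minimizing. *)

Section euclid.
Context {R : realType} {n : nat}.
Implicit Types x y z : 'rV[R]_n.

Lemma dotpC x y : dotp x y = dotp y x.
Proof. by apply: eq_bigr => i _; rewrite mulrC. Qed.

Lemma dotpDl x y z : dotp (x + y) z = dotp x z + dotp y z.
Proof. by rewrite -big_split/=; apply: eq_bigr => i _; rewrite mxE mulrDl. Qed.

Lemma dotpZl a x y : dotp (a *: x) y = a * dotp x y.
Proof. by rewrite mulr_sumr; apply: eq_bigr => i _; rewrite mxE mulrA. Qed.

Lemma dotpDr x y z : dotp z (x + y) = dotp z x + dotp z y.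
Proof. by rewrite dotpC dotpDl !(dotpC _ z). Qed.

Lemma dotpZr a x y : dotp x (a *: y) = a * dotp x y.
Proof. by rewrite dotpC dotpZl dotpC. Qed.

Lemma dotpNl x y : dotp (- x) y = - dotp x y.
Proof. by rewrite -scaleN1r dotpZl mulN1r. Qed.

Lemma dotpNr x y : dotp x (- y) = - dotp x y.
Proof. by rewrite dotpC dotpNl dotpC. Qed.

Lemma dotp0l x : dotp 0 x = 0.
Proof. by rewrite -(scale0r x) dotpZl mul0r. Qed.

Lemma dotp_ge0 x : 0 <= dotp x x.
Proof. by apply: sumr_ge0 => i _; rewrite -expr2 sqr_ge0. Qed.

Lemma enorm_ge0 x : 0 <= enorm x.
Proof. exact: sqrtr_ge0. Qed.

Lemma sqr_enorm x : enorm x ^+ 2 = dotp x x.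
Proof. by rewrite sqr_sqrtr ?dotp_ge0. Qed.

Lemma enorm0 : enorm (0 : 'rV[R]_n) = 0.
Proof. by rewrite /enorm dotp0l sqrtr0. Qed.

Lemma enormZ a x : enorm (a *: x) = `|a| * enorm x.
Proof.
by rewrite /enorm dotpZl dotpZr mulrA -expr2 sqrtrM ?sqr_ge0// sqrtr_sqr.
Qed.

Lemma enormN x : enorm (- x) = enorm x.
Proof. by rewrite -scaleN1r enormZ normrN1 mul1r. Qed.

Lemma ler_coord_enorm x i : `|x 0 i| <= enorm x.
Proof.
rewrite -(@ler_pXn2r _ 2) ?nnegrE ?enorm_ge0// sqr_enorm real_normK ?num_real//.
rewrite /dotp (bigD1 i)//= -expr2 lerDl; apply: sumr_ge0 => j _.
by rewrite -expr2 sqr_ge0.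
Qed.

Lemma enorm_eq0 x : enorm x = 0 -> x = 0.
Proof.
move=> x0; apply/rowP => i; rewrite mxE; apply: normr0_eq0; apply/eqP.
by rewrite eq_le normr_ge0 andbT -x0 ler_coord_enorm.
Qed.

Lemma le_dotp_enorm x y : dotp x y <= enorm x * enorm y.
Proof.
have [y0|y0] := eqVneq (enorm y) 0.
  by rewrite (enorm_eq0 y0) dotpC dotp0l enorm0 mulr0.
have yp : 0 < enorm y by rewrite lt_def y0 enorm_ge0.
rewrite real_leNgt ?num_real//; apply/negP => h.
have : 0 <= dotp (enorm y ^+ 2 *: x - dotp x y *: y)
    (enorm y ^+ 2 *: x - dotp x y *: y) by exact: dotp_ge0.
rewrite !(dotpDl, dotpDr, dotpNl, dotpNr, dotpZl, dotpZr) (dotpC y x).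
rewrite -!sqr_enorm.
have := enorm_ge0 x.
move: (enorm x) (enorm y) (dotp x y) yp h => X Y d yp h x0.
rewrite [X in 0 <= X](_ : _ = Y ^+ 2 * ((X * Y) ^+ 2 - d ^+ 2)); last by ring.
have XY0 : 0 <= X * Y by rewrite mulr_ge0// ltW.
by rewrite pmulr_rge0 ?exprn_gt0// subr_ge0 ler_pXn2r// ?nnegrE
  ?(ltW (le_lt_trans XY0 h))// leNgt h.
Qed.

Lemma ler_norm_dotp x y : `|dotp x y| <= enorm x * enorm y.
Proof.
by rewrite ler_norml le_dotp_enorm andbT lerNl -dotpNl -(enormN x)
  le_dotp_enorm.
Qed.

Lemma ler_enormD x y : enorm (x + y) <= enorm x + enorm y.
Proof.
rewrite -(@ler_pXn2r _ 2) ?nnegrE ?addr_ge0 ?enorm_ge0//.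
rewrite sqr_enorm dotpDl !dotpDr (dotpC y x) sqrrD -!sqr_enorm.
have := le_dotp_enorm x y; lra.
Qed.

Lemma enormB_sym x y : enorm (x - y) = enorm (y - x).
Proof. by rewrite -enormN opprB. Qed.

End euclid.

(** * Superadditivity and subgradients of the energy density *)

Section energy_density.
Context {R : realType} {n : nat}.
Implicit Types (a c b : 'rV[int]_n) (t u : 'rV[R]_n).

Lemma intvD a c : intv (a + c) = intv a + intv c :> 'rV[R]_n.
Proof. by apply/rowP => i; rewrite !mxE intrD. Qed.

Lemma quadratic_psi_ge0 (eta : R) b t : 0 <= eta -> 0 <= quadratic_psi eta b t.
Proof. by move=> eta0; apply: addr_ge0;
  [exact: sqr_ge0 | apply: mulr_ge0 => //; exact: sqr_ge0]. Qed.

(* Reflecting [x] in the hyperplane orthogonal to [t] preserves its norm, so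
   Cauchy-Schwarz bounds [(x.t)(y.t)] from below. *)
Lemma dotp_reflection x (y : 'rV[R]_n) t : enorm t = 1 ->
  dotp x y - enorm x * enorm y <= 2 * (dotp x t * dotp y t).
Proof.
move=> t1; have tt : dotp t t = 1 by rewrite -sqr_enorm t1 expr1n.
have := le_dotp_enorm (x - (2 * dotp x t) *: t) y.
have -> : enorm (x - (2 * dotp x t) *: t) = enorm x.
  congr Num.sqrt.
  rewrite !(dotpDl, dotpDr, dotpNl, dotpNr, dotpZl, dotpZr) tt (dotpC t x).
  ring.
rewrite dotpDl dotpNl dotpZl (dotpC t y); lra.
Qed.

(** The cross term [2 a.c + 2 eta (a.t)(c.t)] is at least [2 a.c + eta (a.c - |a||c|)] by
    reflection. Since [a.c <= |a||c|], the worst case is [eta = 1], where the bound becomes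
    [3 a.c - |a||c|]: this is the origin of the factor 3. *)
Lemma quadratic_psi_superadditive (eta : R) a c t : 0 <= eta <= 1 ->
  enorm t = 1 ->
  enorm (intv a : 'rV[R]_n) * enorm (intv c : 'rV[R]_n) <=
    3 * dotp (intv a) (intv c) :> R ->
  quadratic_psi eta a t + quadratic_psi eta c t <= quadratic_psi eta (a + c) t.
Proof.
move=> /andP[eta0 eta1] t1; have := @dotp_reflection (intv a) (intv c) t t1.
have := le_dotp_enorm (intv a : 'rV[R]_n) (intv c).
rewrite /quadratic_psi intvD !sqr_enorm !dotpDl !dotpDr
  (dotpC (intv c) (intv a)).
move: (dotp (intv a) (intv c)) (enorm _ * enorm _) (dotp _ t) (dotp _ t).
move=> d e p q h1 h2 h3.
have : eta * (d - e) <= eta * (2 * (q * p)) by exact: ler_wpM2l.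
have : (1 - eta) * (d - e) <= 0 by rewrite mulr_ge0_le0 ?subr_ge0 ?subr_le0.
nra.
Qed.

(* The left-hand side is the differential at [t] of the one-homogeneous
   extension of [quadratic_psi eta a], applied to [u]. *)
Lemma quadratic_psi_subgradient (eta : R) a t u : 0 <= eta <= 1 ->
  enorm t = 1 -> enorm u = 1 ->
  (enorm (intv a : 'rV[R]_n) ^+ 2 - eta * dotp (intv a) t ^+ 2) * dotp t u
    + 2 * eta * dotp (intv a) t * dotp (intv a) u <= quadratic_psi eta a u.
Proof.
move=> /andP[eta0 eta1] t1 u1.
have := le_dotp_enorm t u; have := ler_norm_dotp (intv a) t.
rewrite t1 u1 !mulr1 /quadratic_psi -(@ler_pXn2r _ 2) ?nnegrE ?enorm_ge0//.
rewrite real_normK ?num_real//.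
move: (enorm _ ^+ 2) (dotp _ t) (dotp _ u) (dotp _ u) => A p q c Ap c1.
(* The gap between the two sides is exactly the sum of this term and the next one; here
   [eta p^2 <= p^2 <= A]. *)
have : 0 <= (A - eta * p ^+ 2) * (1 - c).
  rewrite mulr_ge0 ?subr_ge0// (le_trans _ Ap)// ler_piMl ?sqr_ge0//.
have : 0 <= eta * (q - p) ^+ 2 by rewrite mulr_ge0 ?sqr_ge0.
nra.
Qed.

End energy_density.

(** * Splitting integer vectors into box points *)

Section splitting.
Context {R : realType} {n : nat}.
Implicit Types (a b : 'rV[int]_n) (t : 'rV[R]_n).

(** The strict decrease of both [l^1] norms makes repeated splitting terminate; the last clause is
    the criterion for superadditivity in every direction. *)
Definition splittable b : Prop := exists a c : 'rV[int]_n,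
  [/\ b = a + c,
    (\sum_i `|a 0%R i| < \sum_i `|b 0%R i|)%N,
    (\sum_i `|c 0%R i| < \sum_i `|b 0%R i|)%N &
    enorm (intv a : 'rV[R]_n) * enorm (intv c : 'rV[R]_n) <=
      3 * dotp (intv a) (intv c) :> R].

(** The remainder [c = b - a] keeps the signs of [b], so for the sign vector [a] one has
    [a.c = |c|_1 >= |c|], while [|a|^2 <= n <= 9]. An entry of modulus at least 2 makes [a] strictly
    smaller than [b]. *)
Lemma splitting_le9 b : (n <= 9)%N -> (exists i, 1 < `|b 0%R i|)%N -> splittable
  b.
Proof.
move=> n9 [i bi]; pose a : 'rV[int]_n := \row_j sgz (b 0 j); exists a, (b - a).
have absBsg (z : int) : (`|(z - sgz z)%R| = `|z| - 1)%N by case: sgzP => ?; lia.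
have sg_lt (z : int) : (1 < `|z| -> `|sgz z| < `|z|)%N by case: sgzP => ?; lia.
have sg_le (z : int) : (`|sgz z| <= `|z|)%N by case: sgzP => ?; lia.
have sg_sqr (z : int) : sgz z * sgz z <= 1 by case: sgzP => ?; lia.
have sgM (z : int) : sgz z * (z - sgz z) = `|z - sgz z| by case: sgzP => ?; lia.
have ba j : (`|(b - a)%R 0%R j| = `|b 0%R j| - 1)%N by rewrite !mxE;
  exact: absBsg.
split; first by rewrite addrC subrK.
- rewrite (bigD1 i)//= [X in (_ < X)%N](bigD1 i)//=.
  rewrite -addSn leq_add//; first by rewrite mxE; exact: sg_lt.
  by apply: leq_sum => j _; rewrite mxE; exact: sg_le.
- rewrite (bigD1 i)//= [X in (_ < X)%N](bigD1 i)//=.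
  rewrite -addSn leq_add//; first by rewrite ba; lia.
  by apply: leq_sum => j _; rewrite ba; lia.
have -> : dotp (intv a) (intv (b - a)) = \sum_i `|intv (b - a) 0 i| :> R.
  apply: eq_bigr => j _; rewrite /intv !mxE.
  rewrite -intrM -intr_norm; congr (_%:~R); exact: sgM.
have a3 : enorm (intv a : 'rV[R]_n) <= 3.
  rewrite -(@ler_pXn2r _ 2) ?nnegrE ?enorm_ge0// sqr_enorm.
  apply: (@le_trans _ _ (\sum_(i < n) 1)).
    apply: ler_sum => j _; rewrite /intv !mxE -intrM -[1]/(1%:~R) ler_int;
      exact: sg_sqr.
  by rewrite sumr_const card_ord -natrX ler_nat.
apply: ler_pM => //; try exact: enorm_ge0.
rewrite -(@ler_pXn2r _ 2) ?nnegrE ?enorm_ge0 ?sumr_ge0// sqr_enorm expr2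
  mulr_suml.
apply: ler_sum => j _; rewrite -expr2 -[X in X <= _]real_normK ?num_real//
  expr2.
rewrite ler_wpM2l// (bigD1 j)//= lerDl sumr_ge0//.
Qed.

(** Put [s = |a + c|^2] and [d = |a - c|^2]. Then [4 a.c = s - d] and [4 |a||c| <= s + d], so the
    criterion follows from [s >= 2 d]. Rounding errors of at most 1 per entry give [d <= n], and one
    large entry gives [s >= 2 n]. *)
Lemma splitting_half b : (exists i, 2 * n < `|b 0%R i|)%N -> splittable b.
Proof.
move=> [i bi].
have n0 : (0 < n)%N by apply: leq_ltn_trans (ltn_ord i).
have half_lt (z : int) : (1 < `|z| -> `|(z %/ 2)%Z| < `|z|)%N by lia.
have half_le (z : int) : (`|(z %/ 2)%Z| <= `|z|)%N by lia.
have halfB_lt (z : int) : (1 < `|z| -> `|(z - (z %/ 2)%Z)%R| < `|z|)%N by lia.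
have halfB_le (z : int) : (`|(z - (z %/ 2)%Z)%R| <= `|z|)%N by lia.
have diff_le (z : int) :
    ((z %/ 2)%Z - (z - (z %/ 2)%Z)) * ((z %/ 2)%Z - (z - (z %/ 2)%Z)) <= 1.
  have : ((z %/ 2)%Z - (z - (z %/ 2)%Z) == 0) ||
    ((z %/ 2)%Z - (z - (z %/ 2)%Z) == -1) by lia.
  by case/orP => /eqP ->.
have sqr_ge (z : int) : (2 * n < `|z|)%N -> (2 * n)%:Z <= z * z by nia.
have b1 : (1 < `|b 0%R i|)%N by lia.
pose a : 'rV[int]_n := \row_j (b 0%R j %/ 2)%Z; exists a, (b - a).
split; first by rewrite addrC subrK.
- rewrite (bigD1 i)//= [X in (_ < X)%N](bigD1 i)//=.
  rewrite -addSn leq_add//; first by rewrite mxE; exact: half_lt.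
  by apply: leq_sum => j _; rewrite mxE; exact: half_le.
- rewrite (bigD1 i)//= [X in (_ < X)%N](bigD1 i)//=.
  rewrite -addSn leq_add//; first by rewrite !mxE; exact: halfB_lt.
  by apply: leq_sum => j _; rewrite !mxE; exact: halfB_le.
set x : 'rV[R]_n := intv a; set y : 'rV[R]_n := intv (b - a).
have d_le : dotp (x - y) (x - y) <= n%:R.
  apply: (@le_trans _ _ (\sum_(i < n) 1)); last by rewrite sumr_const card_ord.
  apply: ler_sum => j _; rewrite /x /y /intv !mxE -intrB -intrM -[1]/(1%:~R)
    ler_int.
  exact: diff_le.
have s_ge : 2 * n%:R <= dotp (x + y) (x + y).
  rewrite -intvD addrC subrK.
  apply: (@le_trans _ _ ((intv b : 'rV[R]_n) 0 i * (intv b : 'rV[R]_n) 0 i)).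
    by rewrite /intv !mxE -intrM -natrM -[X in X <= _]/((Posz (2 * n))%:~R)
      ler_int; exact: sqr_ge.
  by rewrite /dotp (bigD1 i)//= lerDl; apply: sumr_ge0 => j _;
    rewrite -expr2 sqr_ge0.
have := sqr_ge0 (enorm x - enorm y); rewrite sqrrB !sqr_enorm.
move: d_le s_ge; rewrite !(dotpDl, dotpDr, dotpNl, dotpNr) (dotpC y x).
lra.
Qed.

(** One [m] serves all [eta] and [t]. The middle clause is needed because
    [quadratic_psi eta 0 t = 0]: the energy inequality puts no bound on the multiplicity of the zero
    point. *)
Definition box_splitting k (m : 'rV['I_(k.*2.+1)]_n -> nat) b : Prop :=
  [/\ \sum_x (m x)%:Z *: box_point x = b,
      forall x, box_point x = 0 -> m x = 0%N &
      forall (eta : R) t, 0 <= eta <= 1 -> enorm t = 1 ->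
        \sum_x (m x)%:R * quadratic_psi eta (box_point x) t
          <= quadratic_psi eta b t].

Lemma exists_box_splitting k :
  (forall b, (exists i, k < `|b 0%R i|)%N -> splittable b) ->
  forall b, exists m : 'rV['I_(k.*2.+1)]_n -> nat, box_splitting m b.
Proof.
move=> split b; have [N] := ubnP (\sum_i `|b 0%R i|)%N.
elim: N b => // N IH b; rewrite ltnS => bN.
have [/split[a [c [bE aN cN ac]]]|bk] := pselect (exists i, k < `|b 0%R i|)%N.
  have [p [p1 p0 p2]] := IH a (leq_trans aN bN).
  have [q [q1 q0 q2]] := IH c (leq_trans cN bN).
  rewrite bE; exists (fun x => p x + q x)%N; split.
  - rewrite -p1 -q1 -big_split/=; apply: eq_bigr => x _.
    by rewrite PoszD scalerDl.
  - by move=> x x0; rewrite p0 ?q0.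
  - move=> eta t eta01 t1.
    apply: le_trans (quadratic_psi_superadditive eta01 t1 ac).
    apply: le_trans (lerD (p2 _ _ eta01 t1) (q2 _ _ eta01 t1)).
    by rewrite -big_split/=; apply: ler_sum => x _; rewrite natrD mulrDl.
have {}bk i : (`|b 0%R i| <= k)%N.
  by rewrite leqNgt; apply/negP => h; apply: bk; exists i.
(* The vector 0 takes the empty splitting, since multiplicity 1 at its own box point would break the
   clause on the zero point. *)
have [->|b0] := eqVneq b 0.
  exists (fun=> 0%N); split => //.
    by apply: big1 => x _; rewrite scale0r.
  move=> eta t /andP[eta0 _] _; rewrite big1 ?quadratic_psi_ge0// => x _.
  by rewrite mul0r.
pose x0 : 'rV['I_(k.*2.+1)]_n := \row_i inord (absz (b 0 i + k%:Z)).
have x0b : box_point x0 = b.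
  apply/rowP => i; rewrite !mxE inordK; have := bk i; lia.
exists (fun x => (x == x0)%N); split.
- rewrite (bigD1 x0)//= eqxx scale1r x0b big1 ?addr0// => x /negbTE ->.
  by rewrite scale0r.
- move=> x; have [->|//] := eqVneq x x0.
  by rewrite x0b => /eqP; rewrite (negbTE b0).
- move=> eta t _ _; rewrite (bigD1 x0)//= eqxx mul1r x0b big1 ?addr0// => x
  /negbTE ->.
  by rewrite mul0r.
Qed.

End splitting.

(** * Borel sets are H^1-measurable *)

Section metric_outer_measure.
Context {R : realType} {n : nat}.
Local Notation V := 'rV[R]_n.
Local Notation H := (@hausdorff1 R n).
Implicit Types (A B E F : set V) (g : V -> R).
Local Open Scope ereal_scope.

Lemma le_ediam A B : A `<=` B -> ediam A <= ediam B.
Proof.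
move=> AB; apply: le_ereal_sup => _ [->|[x Ax [y Ay <-]]]; first by left.
by right; exists x; [exact: AB|exists y => //; exact: AB].
Qed.

Lemma ediam_ge A x y : A x -> A y -> (enorm (x - y))%:E <= ediam A.
Proof. by move=> Ax Ay; apply: ereal_sup_ubound; right; exists x => //;
  exists y. Qed.

Lemma hausdorff1_pre_anti d d' A : (d <= d')%R ->
  hausdorff1_pre d' A <= hausdorff1_pre d A.
Proof.
move=> dd'; apply: le_ereal_inf_tmp => _ [U [AU Ud] <-].
apply: ereal_inf_lbound; exists U => //; split => // k.
by apply: le_trans (Ud k) _; rewrite lee_fin.
Qed.

Lemma le_hausdorff1_pre d A : (0 < d)%R -> hausdorff1_pre d A <= H A.
Proof. by move=> d0; apply: ereal_sup_ubound; exists d. Qed.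

(** A covering set of diameter at most [d < e] cannot meet both [A] and [B], so tracing a cover on
    each of them does not raise the sum of diameters. *)
Lemma hausdorff1_pre_separated (e : R) d A B : (0 < d < e)%R ->
  (forall x y, A x -> B y -> e <= enorm (x - y))%R ->
  hausdorff1_pre d A + hausdorff1_pre d B <= hausdorff1_pre d (A `|` B).
Proof.
move=> /andP[d0 de] AB; apply: le_ereal_inf_tmp => _ [U [ABU Ud] <-].
have Usep k : U k `&` A = set0 \/ U k `&` B = set0.
  have [UA|/set0P[x [Ux Ax]]] := eqVneq (U k `&` A) set0; first by left.
  have [UB|/set0P[y [Uy By]]] := eqVneq (U k `&` B) set0; first by right.
  have := le_trans (ediam_ge Ux Uy) (Ud k); rewrite lee_fin.
  by move/(le_trans (AB _ _ Ax By)); rewrite leNgt de.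
apply: (@le_trans _ _ (\sum_(k <oo) ediam (U k `&` A)
                       + \sum_(k <oo) ediam (U k `&` B))).
  apply: leeD; apply: ereal_inf_lbound.
    exists (fun k => U k `&` A) => //; split => [x Ax|k]; last first.
      by apply: le_trans (Ud k); apply: le_ediam; exact: subIsetl.
    by have [k _ Ukx] := ABU x (or_introl Ax); exists k.
  exists (fun k => U k `&` B) => //; split => [x Bx|k]; last first.
    by apply: le_trans (Ud k); apply: le_ediam; exact: subIsetl.
  by have [k _ Ukx] := ABU x (or_intror Bx); exists k.
rewrite -nneseriesD; [|by move=> *; exact: ediam_ge0..].
apply: lee_nneseries => [k _ _|k _]; first by rewrite adde_ge0 ?ediam_ge0.
by case: (Usep k) => ->; rewrite ediam0 ?adde0 ?add0e; apply: le_ediam;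
  exact: subIsetl.
Qed.

Lemma hausdorff1_separated (e : R) A B : (0 < e)%R ->
  (forall x y, A x -> B y -> e <= enorm (x - y))%R ->
  H A + H B <= H (A `|` B).
Proof.
move=> e0 AB.
have le_pre d d' : (0 < d)%R -> (0 < d')%R ->
    hausdorff1_pre d A + hausdorff1_pre d' B <= H (A `|` B).
  (* A common scale, finer than both [d] and [d'] and below the separation [e]. *)
  move=> d0 d0'; pose c : R := Num.min (Num.min d d') (e / 2)%R.
  have c0 : (0 < c < e)%R.
    by rewrite !lt_min d0 d0' divr_gt0//= gt_min; apply/orP; right; lra.
  apply: le_trans (le_hausdorff1_pre _ (andP c0).1).
  apply: le_trans (hausdorff1_pre_separated c0 AB).
  by apply: leeD; apply: hausdorff1_pre_anti; rewrite !ge_min lexx ?orbT.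
have [->|] := eqVneq (H (A `|` B)) +oo; first by rewrite leey.
rewrite -ltey -ge0_fin_numE ?hausdorff1_ge0// => ABfin.
have fin E : E `<=` A `|` B -> H E \is a fin_num.
  move=> EAB; rewrite ge0_fin_numE ?hausdorff1_ge0//.
  by apply: le_lt_trans (le_hausdorff1 EAB) _;
    rewrite -ge0_fin_numE ?hausdorff1_ge0.
rewrite -leeBrDr ?fin//.
apply: ge_ereal_sup => _ [d /= d0 <-].
have dfin : hausdorff1_pre d A \is a fin_num.
  rewrite ge0_fin_numE ?hausdorff1_pre_ge0//.
  apply: le_lt_trans (le_hausdorff1_pre A d0) _.
  by rewrite -ge0_fin_numE ?hausdorff1_ge0// fin.
rewrite leeBrDr ?fin// addeC -leeBrDr//.
apply: ge_ereal_sup => _ [d' /= d0' <-].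
by rewrite leeBrDr// addeC le_pre.
Qed.

Lemma hausdorff1_lipschitz_separated g (a b : R) A B : (a < b)%R ->
  (forall x y, `|g x - g y| <= enorm (x - y))%R ->
  (forall x, A x -> g x <= a)%R -> (forall x, B x -> b <= g x)%R ->
  H A + H B <= H (A `|` B).
Proof.
move=> ab g1 Aa Bb; apply: (@hausdorff1_separated (b - a)%R).
  by rewrite subr_gt0.
move=> x y Ax By; apply: le_trans (g1 x y).
by rewrite distrC (le_trans _ (ler_norm _))// lerB ?Aa ?Bb.
Qed.

(* Caratheodory's criterion: the layers [1/(j+2) <= g < 1/(j+1)] with [j] of a
   fixed parity are mutually separated, so the sum of their measures converges.
     *)
Lemma H1_measurable_sublevel g :
  (forall x y, `|g x - g y| <= enorm (x - y))%R ->
  H1_measurable [set x | g x <= 0]%R.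
Proof.
move=> g1; apply: le_caratheodory_measurable => X /=.
rewrite -/(H _) -/(H (X `&` ~` _)) -/(H X).
have [->|] := eqVneq (H X) +oo; first by rewrite leey.
rewrite -ltey => Xfin.
pose t (j : nat) : R := (j.+1%:R^-1)%R.
have t_anti j : (t j.+1 < t j)%R by rewrite ltf_pV2 ?posrE ?ltr_nat.
pose L j := X `&` [set x | t j.+1 <= g x < t j]%R.
pose S j := X `&` [set x | t j <= g x]%R.
have parity p N : \sum_(0 <= j < N) H (L (j.*2 + p)%N) <= H X.
  (* The induction needs the sharper bound by [S], the part of [X] on or above the layers summed so
     far: the next layer of the same parity is separated from it by the skipped layer. *)
  suff : \sum_(0 <= j < N.+1) H (L (j.*2 + p)%N) <= H (S (N.*2 + p).+1).
    move=> h; apply: le_trans (le_trans h (le_hausdorff1 _));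
      last exact: subIsetl.
    by rewrite big_nat_recr//= leeDl// hausdorff1_ge0.
  elim: N => [|N IH].
    by rewrite big_nat1 add0n; apply: le_hausdorff1 => x [Xx /= /andP[h _]].
  rewrite big_nat_recr//=; apply: (le_trans (leeD IH (lexx _))).
  rewrite addeC doubleS !addSn.
  apply: le_trans (le_hausdorff1 (x := L (N.*2 + p).+2 `|` S (N.*2 + p).+1) _).
    by apply: (hausdorff1_lipschitz_separated (t_anti (N.*2 + p).+1) g1) => x
      [_ /=] // /andP[_ /ltW].
  move=> x [[Xx /= /andP[h _]]|[Xx /= h]]; split => //=.
  by rewrite (le_trans _ h)// ltW// (lt_trans (t_anti _)).
have sumL : \sum_(j <oo) H (L j) < +oo.
  apply: (@le_lt_trans _ _ (H X + H X)); last by rewrite lte_add_pinfty.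
  apply: lime_le; first by apply: is_cvg_nneseries => *; exact: hausdorff1_ge0.
  apply: nearW => N.
  apply: (@le_trans _ _ (\sum_(0 <= j < N.*2) H (L j))).
    apply: lee_sum_nneg_natr => [*|]; first exact: hausdorff1_ge0.
    by rewrite -addnn leq_addr.
  have -> : \sum_(0 <= j < N.*2) H (L j) =
     \sum_(0 <= j < N) H (L (j.*2 + 0)%N) + \sum_(0 <= j < N) H
       (L (j.*2 + 1)%N).
    elim: N => [|N IH]; first by rewrite !big_geq ?adde0.
    rewrite doubleS !big_nat_recr//= IH addn0 addn1 -!addeA; congr (_ + _).
    by rewrite addeCA.
  by apply: leeD; exact: parity.
have tail := nneseries_tail_cvg sumL (fun k _ => hausdorff1_ge0 (L k)).
apply/lee_addgt0Pr => e e0.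
have [[N tN]|tN] := pselect (exists N, \sum_(N <= k <oo) H (L k) <= e%:E);
  last first.
  have : e%:E <= 0.
    apply: cvge_to_ge tail _; apply: nearW => N; rewrite ltW// ltNge.
    by apply/negP => h; apply: tN; exists N.
  by rewrite lee_fin leNgt e0.
(* Where [g > 0], [X] consists of [S N] and the layers from [N] on, whose measures sum to at most
   [e]. Since [g >= t N > 0] on [S N], this set is separated from the sublevel set. *)
have : H (X `&` ~` [set x | g x <= 0]%R) <= H (S N) + e%:E.
  apply: (@le_trans _ _ (H (S N `|` \bigcup_j L (j + N)%N))).
    apply: le_hausdorff1 => x [Xx /= /negP]; rewrite -ltNge => gx.
    have [tNx|xtN] := leP (t N) (g x); [by left|right].
    have ex : exists m, (t m <= g x)%R.
      exists (Num.truncn (g x)^-1); rewrite -[leRHS]invrK lef_pV2 ?posrE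
        ?invr_gt0//.
      exact/ltW/truncnS_gt.
    case: (ex_minnP ex) => -[|m] tm mmin.
      have tN0 : (t N <= t 0%N)%R by rewrite lef_pV2 ?posrE// ler_nat.
      by move: (lt_le_trans xtN (le_trans tN0 tm)); rewrite ltxx.
    have Nm : (N <= m)%N.
      rewrite leqNgt; apply/negP => mN; move: xtN; rewrite ltNge => /negP;
        apply.
      apply: le_trans tm; rewrite lef_pV2 ?posrE// ler_nat; exact.
    exists (m - N)%N => //=; rewrite subnK//; split => //=.
    rewrite tm/= ltNge; apply/negP => /mmin; by rewrite ltnn.
  apply: (le_trans (outer_measureU2 (H1_outer R n) _ _)).
  apply: leeD => //; apply: le_trans tN.
  rewrite -nneseries_addn; last by move=> ?; exact: hausdorff1_ge0.
  exact: hausdorff1_sigma_subadditive.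
move=> /(leeD (lexx (H (X `&` [set x | (g x <= 0)%R])))) /le_trans; apply.
rewrite addeA; apply: leeD => //.
have tN0 : (0 < t N)%R by rewrite invr_gt0.
apply: le_trans (le_hausdorff1 (x := (X `&` [set x | (g x <= 0)%R]) `|` S N) _).
  by apply: (hausdorff1_lipschitz_separated tN0 g1) => x [].
by move=> x [[]|[]].
Qed.

Local Close Scope ereal_scope.

(** A closed set is the zero sublevel set of its distance function, which is 1-Lipschitz. The empty
    set is treated apart, as the distance is an infimum over [F]. *)
Lemma H1_measurable_closed F : closed F -> H1_measurable F.
Proof.
move=> cF; have [->|/set0P[y0 Fy0]] := eqVneq F set0.
  exact: (@measurable0 _ (caratheodory_type (H1_outer R n))).
pose d (x : V) := inf [set enorm (x - y) | y in F].
have has_lb x : has_lbound [set enorm (x - y) | y in F].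
  by exists 0 => _ [y _ <-]; exact: enorm_ge0.
have d_le x y : F y -> d x <= enorm (x - y).
  by move=> Fy; apply: ge_inf => //; exists y.
have d_lip x y : d x <= d y + enorm (x - y).
  rewrite -lerBlDr; apply: lb_le_inf; first by exists (enorm (y - y0)), y0.
  move=> _ [z Fz <-]; rewrite lerBlDr (le_trans (d_le x z Fz))//.
  by rewrite [leRHS]addrC (le_trans _ (ler_enormD _ _))// addrA subrK.
suff -> : F = [set x | d x <= 0].
  apply: H1_measurable_sublevel => x y.
  have := d_lip x y; have := d_lip y x; rewrite (enormB_sym y).
  by rewrite ler_norml; lra.
apply/seteqP; split => x /=.
  by move=> Fx; rewrite (le_trans (d_le x x Fx))// subrr enorm0.
move=> dx0; apply: cF => B /nbhs_ballP[e e0 xeB].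
have [_ [y Fy <-] xy] : exists2 z, [set enorm (x - y) | y in F] z & z < e.
  by apply: inf_lt; [exists (enorm (x - y0)), y0|exact: le_lt_trans dx0 e0].
exists y; split => //; apply: xeB; split => // i j; rewrite ord1 /ball/=.
by rewrite (le_lt_trans _ xy)// (le_trans _ (ler_coord_enorm _ j))// !mxE.
Qed.

Lemma H1_measurable_open (U : set V) : open U -> H1_measurable U.
Proof.
move=> oU; rewrite -(setCK U);
  apply: (@measurableC _ (caratheodory_type (H1_outer R n))).
exact/H1_measurable_closed/open_closedC.
Qed.

Lemma borel_open (U : set V) : open U -> borel U.
Proof. exact: sub_sigma_algebra. Qed.

Lemma continuous_H1_measurable (f : V -> R) : continuous f ->
  measurable_fun (setT : set (caratheodory_type (H1_outer R n))) f.
Proof.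
move=> /continuousP cf mD; apply: (measurability _ (RGenOpens.measurableE R)) =>
  //.
move=> _ [_ [a [b ->] <-]]; rewrite setTI; apply: H1_measurable_open.
by apply: cf; exact: interval_open.
Qed.

End metric_outer_measure.

(** * H^1 on a line *)

Section continuity.
Context {R : realType} {n : nat}.
Local Notation V := 'rV[R]_n.

Lemma continuous_dotp (T : topologicalType) (f g : T -> V) :
  continuous f -> continuous g -> continuous (fun x => dotp (f x) (g x)).
Proof.
move=> cf cg; apply: (@continuous_big R _ +%R 0 xpredT) => [|i _ x].
  exact: add_continuous.
apply: cvgM.
  by apply: (@continuous_comp _ _ _ f (fun M : V => M 0 i));
    [exact: cf|exact: coord_continuous].
by apply: (@continuous_comp _ _ _ g (fun M : V => M 0 i));
  [exact: cg|exact: coord_continuous].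
Qed.

Lemma continuous_enorm (T : topologicalType) (f : T -> V) :
  continuous f -> continuous (fun x => enorm (f x)).
Proof.
move=> cf x; apply: (continuous_comp (f := fun x => dotp (f x) (f x))).
  exact: (continuous_dotp cf cf).
exact: (@sqrt_continuous R).
Qed.

Lemma open_eball (c : V) r : open (eball c r).
Proof.
apply: (@open_comp V R (fun x : V => enorm (x - c)) [set y | y < r]);
  last exact: (@open_lt R).
move=> x _; apply: continuous_enorm => y.
exact: (cvgB cvg_id (cvg_cst c)).
Qed.

Lemma closed_closed_eball (c : V) r : closed (closed_eball c r).
Proof.
apply: (@preimage_closed V R (fun x : V => enorm (x - c)) [set y | y <= r]);
  last exact: (@closed_le R).
move=> x _; apply: continuous_enorm => y.
exact: (cvgB cvg_id (cvg_cst c)).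
Qed.

End continuity.

Lemma integral_mrestr d (T : measurableType d) (R : realType)
    (mu : {measure set T -> \bar R}) (D : set T) (mD : measurable D)
    (A : set T) (f : T -> \bar R) :
  measurable A -> (mrestr mu mD).-integrable A f ->
  (\int[mrestr mu mD]_(x in A) f x = \int[mu]_(x in A `&` D) f x)%E.
Proof.
move=> mA intf; transitivity (\int[mrestr mu mD]_(x in A `\` ~` D) f x)%E.
  apply: (@negligible_integral _ _ _ _ A (~` D)) => //;
    first exact: measurableC.
  by rewrite /= /mrestr setICl measure0.
rewrite setDE setCK; apply: eq_measure_integral => B mB BAD.
by rewrite /= /mrestr setIidl// => x /BAD[].
Qed.

Section hausdorff_line.
Context {R : realType} {n : nat}.
Local Notation V := 'rV[R]_n.
Local Notation H := (@hausdorff1 R n).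
Variable t : V.
Hypothesis t1 : enorm t = 1.
Local Open Scope ereal_scope.

Lemma dotp_unit_line s : dotp (s *: t) t = s.
Proof. by rewrite dotpZl -sqr_enorm t1 expr1n mulr1. Qed.

Lemma ediam_segment_le (a b : R) : (a <= b)%R ->
  ediam [set s *: t | s in `[a, b]] <= (b - a)%:E.
Proof.
move=> ab; apply: ge_ereal_sup => _ [->|[_ [s sab <-] [_ [r rab <-] <-]]].
  by rewrite lee_fin subr_ge0.
rewrite lee_fin -scalerBl enormZ t1 mulr1 ler_norml.
move: sab rab; rewrite /= !in_itv/= => /andP[? ?] /andP[? ?].
by apply/andP; split; lra.
Qed.

Lemma hausdorff1_segment_le (a b : R) : (a < b)%R ->
  H [set s *: t | s in `]a, b]] <= (b - a)%:E.
Proof.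
move=> ab; apply: ge_ereal_sup => _ [d /= d0 <-].
pose N := (Num.truncn ((b - a) / d)).+1; pose h : R := ((b - a) / N%:R)%R.
have h0 : (0 < h)%R by rewrite divr_gt0 ?subr_gt0.
have hd : (h <= d)%R.
  by rewrite ler_pdivrMr// mulrC -ler_pdivrMr// ltW// truncnS_gt.
have Nh : (N%:R * h = b - a)%R by rewrite mulrC divfK ?pnatr_eq0.
pose U k := if (k < N)%N
  then [set s *: t | s in `[(a + k%:R * h)%R, (a + k.+1%:R * h)%R]] else set0.
have Ud k : ediam (U k) <= (if (k < N)%N then h else 0%R)%:E.
  rewrite /U; case: ifPn => _; last by rewrite ediam0.
  apply: le_trans (ediam_segment_le _) _;
    first by rewrite lerD2l ler_pM2r ?ler_nat.
  by rewrite lee_fin -natr1; lra.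
apply: (@le_trans _ _ (\sum_(k <oo) ediam (U k))).
  apply: ereal_inf_lbound; exists U => //; split; last first.
    move=> k; apply: le_trans (Ud k) _; rewrite lee_fin; case: ifPn => // _.
    exact: ltW.
  move=> _ [s /= /[!in_itv]/= /andP[sa sb] <-].
  pose k := Num.truncn ((s - a) / h).
  have sa0 : (0 <= (s - a) / h)%R by rewrite divr_ge0 ?subr_ge0 ?(ltW sa)
    ?(ltW h0).
  have := truncn_itv sa0; rewrite -/k ler_pdivlMr// ltr_pdivrMr// =>
    /andP[k1 k2].
  have [kN|Nk] := ltnP k N.
    exists k => //; rewrite /U kN; exists s => //=.
    by rewrite in_itv/=; lra.
  (* Truncation yields [k = N] at the right end [s = b], which belongs to the last closed piece. *)
  exists N.-1 => //; rewrite /U ltnSn; exists s => //=.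
  have : (N%:R * h <= k%:R * h)%R by rewrite ler_pM2r ?ler_nat.
  have : (N.-1%:R * h <= N%:R * h)%R by rewrite ler_pM2r ?ler_nat ?leq_pred.
  by rewrite in_itv/= Nh; lra.
apply: (@le_trans _ _ (\sum_(k <oo) (if (k < N)%N then h else 0%R)%:E)).
  by apply: lee_nneseries => [*|k _]; [exact: ediam_ge0|exact: Ud].
rewrite (nneseries_split 0 N); last by move=> k _; rewrite lee_fin;
  case: ifPn => // _; exact: ltW.
rewrite add0n eseries0 ?adde0; last by move=> k Nk _; rewrite ltnNge Nk.
rewrite big_mkord (eq_bigr (fun=> h%:E)); last by move=> k _; rewrite ltn_ord.
by rewrite sumEFin sumr_const card_ord -mulr_natl Nh.
Qed.

(* Orthogonal projection to the line does not increase diameters. *)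
Lemma hausdorff1_segment_ge (a b : R) : (a < b)%R ->
  (b - a)%:E <= H [set s *: t | s in `]a, b]].
Proof.
(* Covers at scale 1 suffice; the bound on their diameters also makes these finite. Below,
   [[m k, m k + D k]] contains the projection of [U k]. *)
move=> ab; apply: le_trans (le_hausdorff1_pre _ ltr01).
apply: le_ereal_inf_tmp => _ [U [abU Ud] <-].
have Ufin k : ediam (U k) \is a fin_num.
  by rewrite ge0_fin_numE ?ediam_ge0// (le_lt_trans (Ud k)) ?ltry.
pose D k : R := fine (ediam (U k)).
have D0 k : (0 <= D k)%R by rewrite fine_ge0 ?ediam_ge0.
pose m k : R := inf [set dotp x t | x in U k].
have Um k x : U k x -> (m k <= dotp x t <= m k + D k)%R.
  move=> Ux; have dD y : U k y -> (dotp x t <= D k + dotp y t)%R.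
    move=> Uy; rewrite -lerBlDr -dotpNl -dotpDl.
    rewrite (le_trans (le_dotp_enorm _ _))// t1 mulr1 -lee_fin fineK//.
    exact: ediam_ge.
  apply/andP; split.
    apply: ge_inf; last by exists x.
    exists (dotp x t - D k)%R => _ [y Uy <-]; have := dD _ Uy; lra.
  rewrite -lerBlDr; apply: lb_le_inf; first by exists (dotp x t), x.
  by move=> _ [y Uy <-]; have := dD _ Uy; lra.
have -> : (b - a)%:E = lebesgue_measure (`]a, b]%classic : set R).
  by rewrite lebesgue_measure_itv/= lte_fin ab.
apply: (@le_trans _ _ (\sum_(k <oo) lebesgue_measure
  (`[m k, (m k + D k)%R]%classic : set R))).
  apply: measure_sigma_subadditive => // s sab.
  have [k _ Uk] := abU (s *: t) (ex_intro2 _ _ s sab erefl).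
  by exists k => //=; rewrite in_itv/= -(dotp_unit_line s) Um.
apply: lee_nneseries => [|k _]; first by [].
rewrite lebesgue_measure_itv/= lte_fin; case: ifPn => _; last exact: ediam_ge0.
by rewrite -EFinB addrC addKr fineK.
Qed.

Lemma closed_line : closed (line t).
Proof.
have -> : line t = [set x : V | (enorm (x - dotp x t *: t) <= 0)%R].
  apply/seteqP; split => [_ [s _ <-]|x /= x0] /=.
    by rewrite dotp_unit_line subrr enorm0.
  have /enorm_eq0/subr0_eq -> : enorm (x - dotp x t *: t) = 0%R.
    by apply/eqP; rewrite eq_le x0 enorm_ge0.
  by exists (dotp x t).
apply: (@preimage_closed V R (fun x : V => enorm (x - dotp x t *: t))
  [set y | (y <= 0)%R]); last exact: (@closed_le R).
move=> x _; apply: continuous_enorm => y.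
apply: (cvgB cvg_id); apply: cvgZr_tmp.
by apply: (@continuous_dotp _ _ V id (cst t)) => z;
  [exact: cvg_id|exact: cst_continuous].
Qed.

Lemma H1_measurable_line : H1_measurable (line t).
Proof. exact/H1_measurable_closed/closed_line. Qed.

Let T := caratheodory_type (H1_outer R n).

Lemma measurable_dotp : measurable_fun (setT : set T)
  (fun x => dotp x t : measurableTypeR R).
Proof.
apply: continuous_H1_measurable.
by apply: (@continuous_dotp _ _ V id (cst t)) => z;
  [exact: cvg_id|exact: cst_continuous].
Qed.

Let mline : measurable (line t : set T) := H1_measurable_line.
Let restr : {measure set T -> \bar R} := mrestr (@H1 R n) mline.
Let push : {measure set (measurableTypeR R) -> \bar R} :=
  measure_function_pushforward__canonical__measure_function_Measure restr
    measurable_dotp.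

(** The image of [H^1] on the line under [x |-> x.t] gives every []a, b]] its length, and Lebesgue
    measure is the only measure that does. *)
Lemma pushforward_H1_line (A : set (measurableTypeR R)) : measurable A ->
  lebesgue_measure A = H1 R n ((fun x => dotp x t) @^-1` A `&` line t).
Proof.
move=> mA; rewrite [RHS](_ : _ = push A)//.
apply: lebesgue_measure_unique => // _ [[a b] _ <-] /=.
rewrite lebesgue_measure_itv/= lte_fin /push /pushforward /restr/= /mrestr.
have -> : (fun x => dotp x t) @^-1` `]a, b] `&` line t = [set s *: t | s in `]a,
  b]].
  apply/seteqP; split => [x [/= xab [s _ sx]]|_ [s sab <-]].
    by exists s => //; rewrite -(dotp_unit_line s) sx.
  by split => /=; [rewrite dotp_unit_line|exists s].
have [ab|ba] := ltP a b.
  by apply/eqP; rewrite eq_le hausdorff1_segment_ge//= hausdorff1_segment_le.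
rewrite set_itv_ge ?image_set0 ?measure0//.
by rewrite bnd_simp -leNgt.
Qed.

End hausdorff_line.

Section integral_line.
Context {R : realType} {n : nat}.
Variable t : 'rV[R]_n.
Hypothesis t1 : enorm t = 1.
Local Open Scope ereal_scope.
Let T := caratheodory_type (H1_outer R n).
Let mline : measurable (line t : set T) := H1_measurable_line t1.
Let restr : {measure set T -> \bar R} := mrestr (@H1 R n) mline.
Let push : {measure set (measurableTypeR R) -> \bar R} :=
  measure_function_pushforward__canonical__measure_function_Measure restr
    (measurable_dotp t).

Lemma integral_H1_line (A : set (measurableTypeR R)) (F : R -> R) (M : R) :
  measurable A -> lebesgue_measure A < +oo ->
  measurable_fun (setT : set (measurableTypeR R)) F -> (forall s, `|F s| <= M)%R
    ->
  (H1 R n).-integrable ((fun x => dotp x t) @^-1` A `&` line t)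
    (fun x => (F (dotp x t))%:E) /\
  \int[H1 R n]_(x in (fun x => dotp x t) @^-1` A `&` line t) (F (dotp x t))%:E
    = \int[lebesgue_measure]_(s in A) (F s)%:E.
Proof.
move=> mA Afin mF FM.
have mpA : measurable ((fun x => dotp x t) @^-1` A : set T).
  by rewrite -[X in measurable X]setTI; exact: (measurable_dotp t).
have mFp : measurable_fun (setT : set T) (fun x => F (dotp x t)).
  exact: (measurableT_comp mF (measurable_dotp t)).
have restrA : restr ((fun x => dotp x t) @^-1` A) = lebesgue_measure A.
  by rewrite (pushforward_H1_line t1).
have bF (B : set T) : [bounded F (dotp x t) | x in B].
  exists M; split; first exact: num_real.
  by move=> x Mx y _; rewrite /= (le_trans (FM _))// ltW.
split.
  apply: measurable_bounded_integrable.
  - exact: measurableI.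
  - by rewrite -(pushforward_H1_line t1 mA).
  - exact: measurable_funTS.
  - exact: bF.
have ipush : restr.-integrable ((fun x => dotp x t) @^-1` A)
    (EFin \o (fun x => F (dotp x t))).
  apply: measurable_bounded_integrable.
  - exact: mpA.
  - by rewrite restrA.
  - exact: measurable_funTS.
  - exact: bF.
rewrite (@eq_measure_integral _ _ _ _ push); last first.
  by move=> B mB _; exact: (pushforward_H1_line t1).
rewrite (integral_pushforward (measurable_dotp t)
  (proj2 (measurable_EFinP _ _) mF) ipush mA).
exact/esym/(integral_mrestr mpA ipush).
Qed.

End integral_line.

(** * Smooth cutoffs *)

Section flat_functions.
Context {R : realType}.

(* Flat at [0] for every [k]; their linear span is closed under derivation. *)
Definition flat (k : nat) (s : R) : R :=
  if 0 < s then s^-1 ^+ k * expR (- s^-1) else 0.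

(** For [u = 1/s > 0], [exp u] dominates the term [u^(k+2) / (k+2)!] of its series. The quadratic
    bound is what makes the derivative of [flat k] at 0 vanish. *)
Lemma flat_le k s : `|flat k s| <= (k.+2)`!%:R * s ^+ 2.
Proof.
rewrite /flat; case: ifPn => [s0|_]; last by rewrite normr0 mulr_ge0 ?sqr_ge0.
have u0 : 0 < s^-1 by rewrite invr_gt0.
rewrite ger0_norm; last by rewrite mulr_ge0 ?expR_ge0 ?exprn_ge0// ltW.
have e0 : 0 < s^-1 ^+ k.+2 / k.+2`!%:R by rewrite divr_gt0 ?exprn_gt0 ?ltr0n
  ?fact_gt0.
have : s^-1 ^+ k.+2 / k.+2`!%:R <= expR s^-1.
  by apply: le_trans (expR_ge1Dxn k.+1 (ltW u0)); rewrite lerDr.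
rewrite -lef_pV2 ?posrE ?expR_gt0// -expRN invf_div => h.
apply: (le_trans (ler_wpM2l (exprn_ge0 _ (ltW u0)) h)).
rewrite mulrCA ler_wpM2l// -addn2 exprD invfM mulrA divff ?mul1r.
  by rewrite expr2 invfM !invrK -expr2.
by rewrite gt_eqF ?exprn_gt0.
Qed.

Lemma is_derive_flat k (s : R) :
  is_derive s 1 (flat k) (flat k.+2 s - k%:R * flat k.+1 s).
Proof.
have [s0|s0|->] := ltgtP s 0.
- rewrite /flat ltNge (ltW s0)/= mulr0 subr0.
  apply: (@near_eq_is_derive _ _ _ (cst 0)).
    near=> x; rewrite ifF//; apply/negbTE; rewrite -leNgt ltW//.
    by near: x; exact: lt_nbhsl.
- rewrite /flat s0.
  apply: (@near_eq_is_derive R R R (fun s : R => s^-1 ^+ k * expR (- s^-1))).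
    near=> x; rewrite ifT//.
    by near: x; exact: lt_nbhsr.
  have dV : is_derive s 1 (fun s : R => s^-1) (- s^-1 ^+ 2).
    have := @is_deriveV R id s 1 1 (lt0r_neq0 s0) (is_derive_id _ _).
    by rewrite scaler1 exprVn.
  have dE : is_derive s 1 (fun s : R => expR (- s^-1))
    (expR (- s^-1) * s^-1 ^+ 2).
    apply: (@is_derive1_comp R expR (fun s : R => - s^-1)).
    by apply: is_derive_eq; rewrite opprK.
  have dX : is_derive s 1 (fun s : R => s^-1 ^+ k) (- (k%:R * s^-1 ^+ k.+1)).
    case: k => [|m]; first by rewrite mul0r oppr0; apply: is_derive_cst.
    have := @is_deriveX R R (fun s : R => s^-1) m.+1 s 1 _ dV.
    rewrite (_ : (fun s : R => s^-1) ^+ m.+1 = (fun s : R => s^-1 ^+ m.+1)).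
      move=> D; apply: (is_derive_eq D).
      by rewrite /GRing.scale/= mulrN -mulrA -exprD addn2.
    by apply/funext => z; elim: m.+1 => [//|q IH]; rewrite !exprS -IH.
  apply: (is_derive_eq (is_deriveM dX dE)).
  by rewrite /GRing.scale/= (exprS _ k.+1) (exprS _ k); ring.
- suff h : h^-1 *: (flat k (h *: 1 + 0) - flat k 0) @[h --> 0^'] --> (0 : R).
    have e0 : flat k.+2 0 - k%:R * flat k.+1 0 = 0 :> R.
      by rewrite /flat ltxx mulr0 subr0.
    rewrite /= in e0 *; rewrite e0; apply: DeriveDef; first exact: (cvgP _ h).
    exact: (cvg_lim _ h).
  apply/cvgr0Pnorm_le => e e0; near=> h.
  have h0 : h != 0 by near: h; exact: nbhs_dnbhs_neq.
  rewrite {2}/flat ltxx subr0 addr0 normrM normfV.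
  rewrite ler_pdivrMl ?normr_gt0//; apply: le_trans (flat_le _ _) _.
  rewrite -[h *: 1]/(h * 1) mulr1 -[h ^+ 2]real_normK ?num_real// expr2 mulrCA.
  rewrite ler_wpM2l// -ler_pdivlMl ?ltr0n ?fact_gt0//.
  near: h; apply: dnbhs0_le; rewrite mulr_gt0// invr_gt0 ltr0n fact_gt0//.
Unshelve. all: by end_near. Qed.

Lemma flat_gt0 k s : 0 < s -> 0 < flat k s.
Proof. by move=> s0; rewrite /flat s0 mulr_gt0 ?expR_gt0 ?exprn_gt0 ?invr_gt0.
  Qed.

Lemma flat0 k s : s <= 0 -> flat k s = 0.
Proof. by move=> s0; rewrite /flat ltNge s0. Qed.

End flat_functions.

Section smooth_functions.
Context {R : realType} {n : nat}.
Local Notation V := 'rV[R]_n.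
Local Notation pd j f := ('D_(delta_mx 0 j) f).

(* The class is stable under partial derivatives, so its members are C^oo. *)
Inductive smooth : (V -> R) -> Prop :=
| smooth_cst c : smooth (cst c)
| smooth_coord i : smooth (fun x => x 0 i)
| smoothD f g : smooth f -> smooth g -> smooth (f \+ g)
| smoothM f g : smooth f -> smooth g -> smooth (f \* g)
| smooth_flat k f : smooth f -> smooth (flat k \o f).

Lemma derive_coord i (v x : V) : 'D_v (fun y : V => y 0 i : R) x = v 0 i.
Proof.
apply: cvg_lim => //; apply: cvg_near_cst; near=> h.
have h0 : h != 0 by near: h; exact: nbhs_dnbhs_neq.
by rewrite /= !mxE addrK /GRing.scale/= mulKf.
Unshelve. all: by end_near. Qed.

Lemma smooth_differentiable f x : smooth f -> differentiable f x.
Proof.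
elim=> [c|i|{}f g _ df _ dg|{}f g _ df _ dg|k {}f _ df].
- exact: differentiable_cst.
- exact: differentiable_coord.
- exact: differentiableD.
- exact: differentiableM.
- apply: differentiable_comp => //; apply/derivable1_diffP.
  by have := is_derive_flat k (f x) => -[].
Qed.

Lemma smooth_partial f j : smooth f -> smooth (pd j f).
Proof.
have dv h x : smooth h -> derivable h x (delta_mx 0 j).
  by move=> sh; exact/diff_derivable/smooth_differentiable.
elim=> [c|i|{}f g sf df sg dg|{}f g sf df sg dg|k {}f sf df].
- rewrite [X in smooth X](_ : _ = cst 0); first exact: smooth_cst.
  by apply/funext => x; rewrite derive_cst.
- rewrite [X in smooth X](_ : _ = cst ((i == j)%:R)); first exact: smooth_cst.
  by apply/funext => x; rewrite derive_coord mxE eqxx.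
- rewrite [X in smooth X](_ : _ = (pd j f) \+ (pd j g)); first exact: smoothD.
  by apply/funext => x; rewrite deriveD//; exact: dv.
- rewrite [X in smooth X](_ : _ = (f \* (pd j g)) \+ (g \* (pd j f))).
    by apply: smoothD; apply: smoothM.
  by apply/funext => x; rewrite deriveM//; exact: dv.
- rewrite [X in smooth X](_ : _ =
    ((flat k.+2 \o f) \+ (cst (- k%:R) \* (flat k.+1 \o f))) \* (pd j f)).
    apply: smoothM => //; apply: smoothD; first exact: smooth_flat.
    by apply: smoothM; [exact: smooth_cst|exact: smooth_flat].
  apply/funext => x.
  have [dfk dfkE] := is_derive_flat k (f x).
  have dflat : differentiable (flat k) (f x) by exact/derivable1_diffP.
  rewrite deriveE; last first.
    by apply: differentiable_comp => //; exact: smooth_differentiable.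
  rewrite diff_comp; [|exact: smooth_differentiable sf|exact: dflat].
  rewrite /= -(deriveE _ (smooth_differentiable x sf)).
  by rewrite (diff1E dflat)/= derive1E dfkE /GRing.scale/= mulrC mulNr.
Qed.

Lemma smooth_iter_partial f s x : smooth f -> differentiable (iter_partial s f)
  x.
Proof.
move=> sf; apply: smooth_differentiable.
by elim: s => //= j s; exact: smooth_partial.
Qed.

Lemma smooth_continuous f : smooth f -> continuous f.
Proof. by move=> sf x; exact/differentiable_continuous/smooth_differentiable.
  Qed.

Lemma smooth_sum (I : Type) (r : seq I) (F : I -> V -> R) :
  (forall i, smooth (F i)) -> smooth (fun x => \sum_(i <- r) F i x).
Proof.
move=> sF; elim: r => [|i r IH].
  rewrite (_ : (fun _ => _) = cst 0); first exact: smooth_cst.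
  by apply/funext => x; rewrite big_nil.
rewrite (_ : (fun _ => _) = F i \+ (fun x => \sum_(i <- r) F i x)).
  exact: smoothD.
by apply/funext => x; rewrite big_cons.
Qed.

Lemma smooth_dotp : smooth (fun x => dotp x x).
Proof. by apply: smooth_sum => i; apply: smoothM; exact: smooth_coord. Qed.

(* [1 - flat 0 (s - a) / flat 0 (b - a)] is [1] for [s <= a] and nonpositive
   for [s >= b]. *)
Lemma exists_cutoff (a b : R) : a < b -> exists chi : V -> R,
  [/\ smooth chi, forall x, dotp x x <= a -> chi x = 1 &
      forall x, b <= dotp x x -> chi x = 0].
Proof.
move=> ab; have c0 : 0 < flat 0 (b - a) by rewrite flat_gt0// subr_gt0.
pose g (x : V) := 1 + - (flat 0 (b - a))^-1 * flat 0 (dotp x x + - a).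
have sg : smooth g.
  apply: (smoothD (smooth_cst 1)); apply: (smoothM (smooth_cst _)).
  by apply: smooth_flat; apply: (smoothD smooth_dotp (smooth_cst _)).
(* Composition with [flat 0] sends the nonpositive values of [g] to 0 and preserves smoothness;
   [flat 0 1] normalizes the value on the inner ball. *)
exists (fun x => (flat 0 1)^-1 * flat 0 (g x)); split.
- exact: (smoothM (smooth_cst _) (smooth_flat 0 sg)).
- move=> x xa; rewrite /g [flat 0 (dotp x x - a)]flat0 ?subr_le0// mulr0 addr0.
  by rewrite mulVf// gt_eqF// flat_gt0.
- move=> x bx; rewrite [flat 0 (g x)]flat0 ?mulr0//.
  rewrite /g mulNr subr_le0 mulrC ler_pdivlMr// mul1r.
  rewrite /flat !subr_gt0 ab (lt_le_trans ab bx) !expr0 !mul1r ler_expR lerN2.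
  by rewrite lef_pV2 ?posrE ?subr_gt0 ?(lt_le_trans ab bx)// lerB.
Qed.

End smooth_functions.

(** * Integrals determined by level sets *)

Section level_sets.
Context d (T : measurableType d) (R : realType)
  (mu : {measure set T -> \bar R}).
Implicit Types (E : set T) (w f : T -> R).

Lemma integrable_bounded_mul E w f (M : R) : measurable E ->
  mu.-integrable E (EFin \o w) -> measurable_fun E f ->
  (forall x, E x -> `|f x| <= M) -> mu.-integrable E
    (EFin \o (fun x => f x * w x)).
Proof.
move=> mE iw mf fM.
have mw : measurable_fun E w by apply/measurable_EFinP;
  exact: measurable_int iw.
apply: (le_integrable mE (g := fun x => (M%:E * (w x)%:E)%E)).
- by apply/measurable_EFinP; apply: measurable_funM.
- move=> x Ex; rewrite -EFinM /= lee_fin !normrM ler_wpM2r//.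
  by rewrite (le_trans (fM x Ex))// ler_norm.
- by apply: integrableZl.
Qed.

Lemma Rintegral_sum E (I : Type) (r : seq I) (g : I -> T -> R) : measurable E ->
  (forall i, mu.-integrable E (EFin \o g i)) ->
  \int[mu]_(x in E) (\sum_(i <- r) g i x) = \sum_(i <- r) \int[mu]_(x in E) g i
    x.
Proof.
move=> mE ig; rewrite /Rintegral.
under eq_integral do rewrite -sumEFin.
rewrite (integral_sum mE ig) -sum_fine// => i _.
exact: (integrable_fin_num mE (ig i)).
Qed.

(** The function [f] is rounded down to the grid [e (i - N)], whose [2 N] cells cover all its
    values; the error is at most [e] pointwise. Only the masses of level sets enter the sum, so [w]
    may change sign. *)
Lemma Rintegral_level_approx E w f (e : R) (N : nat) :
  measurable E -> mu.-integrable E (EFin \o w) ->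
  measurable_fun (setT : set T) f -> 0 < e ->
  (forall x, `|f x| < N%:R * e) ->
  `|\int[mu]_(x in E) (f x * w x) -
    \sum_(i < N.*2) (e * (i%:R - N%:R)) *
      \int[mu]_(x in E `&` f @^-1` `[e * (i%:R - N%:R), e * (i%:R - N%:R) + e[)
        w x|
  <= e * \int[mu]_(x in E) `|w x|.
Proof.
move=> mE iw mf e0 fN.
pose c (i : 'I_N.*2) : R := e * (i%:R - N%:R).
pose A i : set T := f @^-1` `[c i, c i + e[.
have mA i : measurable (A i) by rewrite -[A i]setTI; exact: mf.
have mw : measurable_fun E w by apply/measurable_EFinP;
  exact: measurable_int iw.
have inw i : mu.-integrable E (EFin \o (fun x => \1_(A i) x * w x)).
  apply: le_integrable iw => //.
    by apply/measurable_EFinP; apply: measurable_funM => //;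
      exact: measurable_indic.
  move=> x _; rewrite /= lee_fin normrM ler_piMl// indicE.
  by case: (_ \in _); rewrite ?normr1 ?normr0.
have intA i : \int[mu]_(x in E `&` A i) w x = \int[mu]_(x in E)
  (\1_(A i) x * w x).
  rewrite Rintegral_mkcondr; apply: eq_Rintegral => x _.
  by rewrite patchE indicE; case: (_ \in _); rewrite ?mul1r ?mul0r.
have incw i : mu.-integrable E (EFin \o (fun x => c i * (\1_(A i) x * w x))).
  by rewrite (_ : _ \o _ = fun x => ((c i)%:E * (\1_(A i) x * w x)%:E)%E)//;
    apply: integrableZl; [exact: mE|exact: inw].
pose s x := \sum_i c i * \1_(A i) x.
have intS : \sum_i c i * \int[mu]_(x in E `&` A i) w x
    = \int[mu]_(x in E) (s x * w x) /\
    mu.-integrable E (EFin \o (fun x => s x * w x)).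
  have sE x : s x * w x = \sum_i c i * (\1_(A i) x * w x).
    by rewrite mulr_suml; apply: eq_bigr => i _; rewrite mulrA.
  split.
    under [RHS]eq_Rintegral do rewrite sE.
    rewrite Rintegral_sum//; apply: eq_bigr => i _; rewrite intA RintegralZl//.
  rewrite (_ : _ \o _ = fun x => (\sum_i (c i * (\1_(A i) x * w x))%:E)%E).
    by apply: integrable_sum => // i _; exact: incw.
  by apply/funext => x /=; rewrite sE sumEFin.
have fs x : `|f x - s x| <= e.
  have N0 := fN x.
  have fN0 : 0 <= f x / e + N%:R.
    move: N0; rewrite ltr_norml => /andP[h _].
    by rewrite -lerBlDr sub0r ler_pdivlMr// mulNr ltW.
  have := truncn_itv fN0; set i0 := Num.truncn _ => /andP[h1 h2].
  have i0N : (i0 < N.*2)%N.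
    rewrite -(ltr_nat R) (le_lt_trans h1)// -addnn natrD ltrD2r ltr_pdivrMr//.
    by rewrite (le_lt_trans (ler_norm _)).
  have Ax i : (\1_(A i) x : R) = (i == Ordinal i0N)%:R.
    rewrite indicE (_ : (x \in A i) = (i == Ordinal i0N))//; apply/idP/eqP.
      rewrite inE /A /= in_itv/= /c => /andP[a1 a2]; apply/val_inj => /=.
      have i_le : i%:R <= f x / e + N%:R.
        by rewrite -lerBlDr ler_pdivlMr// mulrC.
      have i_lt : f x / e + N%:R < i.+1%:R.
        by rewrite -ltrBrDr ltr_pdivrMr// -natr1; lra.
      apply/eqP; rewrite eqn_leq -(ltnS i) -(ltnS i0) -!(ltr_nat R).
      by rewrite (le_lt_trans i_le h2) (le_lt_trans h1 i_lt).
    move=> ->; rewrite inE /A /= in_itv/= /c/=; apply/andP; split.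
      by rewrite mulrC -ler_pdivlMr// lerBlDr.
    have : f x / e < i0%:R + 1 - N%:R by rewrite ltrBrDr natr1.
    by rewrite ltr_pdivrMr//; lra.
  rewrite /s (bigD1 (Ordinal i0N))//= big1 ?addr0; last first.
    by move=> i /negbTE iN; rewrite Ax iN mulr0.
  rewrite Ax eqxx mulr1 /c/=.
  have : f x / e < i0%:R + 1 - N%:R by rewrite ltrBrDr natr1.
  have : i0%:R - N%:R <= f x / e by rewrite lerBlDr.
  rewrite ltr_pdivrMr// ler_pdivlMr// => g1 g2.
  rewrite ger0_norm; lra.
have ifw : mu.-integrable E (EFin \o (fun x => f x * w x)).
  apply: (@integrable_bounded_mul _ _ _ (N%:R * e)) => //.
    exact: measurable_funTS.
  by move=> x _; exact/ltW/fN.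
rewrite (_ : \sum_i _ = \int[mu]_(x in E) (s x * w x)) ?intS.1//.
rewrite -RintegralB//; last exact: intS.2.
have idiff : mu.-integrable E (EFin \o (fun x => f x * w x - s x * w x)).
  rewrite (_ : _ \o _ = fun x => ((f x * w x)%:E - (s x * w x)%:E)%E)//.
  by apply: integrableB; [exact: mE|exact: ifw|exact: intS.2].
apply: le_trans (le_normr_Rintegral mE idiff) _.
have iabs : mu.-integrable E (EFin \o (fun x => `|w x|)) by exact:
  integrable_norm.
rewrite -RintegralZl//; apply: le_Rintegral => //.
- exact: integrable_norm idiff.
- by rewrite (_ : _ \o _ = fun x => (e%:E * `|w x|%:E)%E)//;
  apply: integrableZl.
- by move=> x _; rewrite -mulrBl normrM ler_wpM2r.
Qed.

(** The grid passes through 0, and the cell [[0, h[] has weight 0. All other cells avoid the value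
    0, so agreement on such level sets is enough. *)
Lemma eq_Rintegral_levels E1 E2 w1 w2 f (M : R) :
  measurable E1 -> measurable E2 ->
  mu.-integrable E1 (EFin \o w1) -> mu.-integrable E2 (EFin \o w2) ->
  measurable_fun (setT : set T) f -> (forall x, `|f x| <= M) ->
  (forall a b, a < b -> 0 \notin `[a, b[ ->
    \int[mu]_(x in E1 `&` f @^-1` `[a, b[) w1 x =
    \int[mu]_(x in E2 `&` f @^-1` `[a, b[) w2 x) ->
  \int[mu]_(x in E1) (f x * w1 x) = \int[mu]_(x in E2) (f x * w2 x).
Proof.
move=> mE1 mE2 iw1 iw2 mf fM w12; apply/eqP; rewrite -subr_eq0 -normr_le0.
apply/ler_addgt0Pr => e e0; rewrite add0r.
set I1 := \int[mu]_(x in E1) _; set I2 := \int[mu]_(x in E2) _.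
pose C : R := \int[mu]_(x in E1) `|w1 x| + \int[mu]_(x in E2) `|w2 x| + 1.
have C0 : 0 < C by rewrite ltr_wpDl// addr_ge0 ?Rintegral_ge0.
pose h := e / C; have h0 : 0 < h by rewrite divr_gt0.
pose N := (Num.truncn (M / h)).+1.
have fN x : `|f x| < N%:R * h.
  rewrite -ltr_pdivrMr// (le_lt_trans _ (truncnS_gt _))//.
  by rewrite ler_wpM2r ?fM ?invr_ge0 ?ltW.
have A1 := Rintegral_level_approx mE1 iw1 mf h0 fN.
have A2 := Rintegral_level_approx mE2 iw2 mf h0 fN.
pose c (i : nat) : R := h * (i%:R - N%:R).
rewrite (_ : (\sum_i _) = \sum_(i < N.*2) c i *
   \int[mu]_(x in E2 `&` f @^-1` `[c i, c i + h[) w2 x) in A1; last first.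
  apply: eq_bigr => i _; have [->|iN] := eqVneq (i : nat) N.
    by rewrite /c subrr mulr0 !mul0r.
  congr (_ * _); apply: w12; first by rewrite ltrDl.
  rewrite in_itv/= negb_and -!ltNge -leNgt.
  have [lt|gt|e0'] := ltngtP (i : nat) N; last by rewrite e0' eqxx in iN.
    apply/orP; right; have : (i.+1%:R <= N%:R :> R) by rewrite ler_nat.
    rewrite -natr1 => iN1; have : h * (i%:R + 1 - N%:R) <= 0.
      by rewrite mulr_ge0_le0 ?subr_le0// ltW.
    rewrite /c; lra.
  by apply/orP; left; rewrite /c mulr_gt0 ?subr_gt0 ?ltr_nat.
move: A1 A2; rewrite -/(c _) => A1 A2.
set S := \sum_i _ in A1.
have -> : I1 - I2 = (I1 - S) - (I2 - S) by ring.
apply: (le_trans (ler_normB _ _)); apply: (le_trans (lerD A1 A2)).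
by rewrite -mulrDr /h mulrAC ler_pdivrMr// ler_pM2l// /C lerDl.
Qed.

End level_sets.

(** * Test functions *)

Section test_functions.
Context {R : realType} {n : nat}.
Local Notation V := 'rV[R]_n.
Local Notation pd j f := ('D_(delta_mx 0 j) f).

Lemma compact_closed_eball r : compact (closed_eball (0 : V) r).
Proof.
apply: bounded_closed_compact; last exact: closed_closed_eball.
exists (`|r|); split; first exact: num_real.
move=> M rM x; rewrite /closed_eball/= subr0 => xr.
have M0 : 0 <= M by rewrite (le_trans _ (ltW rM)).
rewrite [leLHS]mx_normrE; apply: bigmax_le => // -[i j] _ /=.
rewrite ord1 (le_trans (ler_coord_enorm x j))// (le_trans xr)//.
by rewrite (le_trans (ler_norm _))// ltW.
Qed.

Lemma derive_eq_on_open (f g : V -> R) (U : set V) v x : open U -> U x ->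
  (forall y, U y -> f y = g y) -> 'D_v f x = 'D_v g x.
Proof.
move=> oU Ux fg; apply: near_eq_derive.
by apply: filterS (open_nbhs_nbhs (conj oU Ux)) => y; exact: fg.
Qed.

Lemma derive_partial (f : V -> R) (t x : V) : smooth f ->
  'D_t f x = \sum_j t 0 j * pd j f x.
Proof.
move=> sf; have df := smooth_differentiable x sf.
rewrite deriveE// {1}(row_sum_delta t) linear_sum/=.
by apply: eq_bigr => j _; rewrite linearZ/= deriveE.
Qed.

Lemma smooth_bounded_partial (f : V -> R) r : smooth f ->
  (forall x, r <= enorm x -> f x = 0) ->
  exists M, forall j x, `|pd j f x| <= M.
Proof.
move=> sf f0.
have pd0 j x : r < enorm x -> pd j f x = 0.
  move=> rx; rewrite (@derive_eq_on_open f (cst 0) [set y | r < enorm y])//.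
  - by rewrite derive_cst.
  - apply: (@open_comp V R (fun y : V => enorm y) [set y | r < y]);
    last exact: (@open_gt R).
    by move=> y _; apply: (@continuous_enorm _ _ V id) => z; exact: cvg_id.
  - by move=> y /= /ltW; exact: f0.
have bnd j : exists M, forall x, `|pd j f x| <= M.
  have cpd : continuous (fun x => `|pd j f x|).
    move=> x; apply: (@continuous_comp V R R (pd j f) (fun y : R => `|y|)).
      exact: (smooth_continuous (smooth_partial j sf)).
    exact: norm_continuous.
  have [||c _ Hc] := @EVT_max_rV R n (fun x => `|pd j f x|) _ _
    (@compact_closed_eball `|r|).
  - by exists 0; rewrite /closed_eball/= subrr enorm0.
  - exact: continuous_subspaceT.
  exists `|pd j f c| => x; have [xr|xr] := leP (enorm x) `|r|.
    by apply: Hc; rewrite inE /closed_eball/= subr0.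
  by rewrite pd0 ?normr0// (le_lt_trans (ler_norm _) xr).
have [M HM] := choice bnd.
exists (\sum_j `|M j|) => j x;
  rewrite (le_trans (HM j x))// (le_trans (ler_norm _))//.
by rewrite (bigD1 j)//= lerDl sumr_ge0.
Qed.

Lemma exists_test_function (r : R) (k : 'I_n) : 0 <= r < 2^-1 ->
  exists phi : V -> R, [/\ smooth phi, test_function (eball 0 2^-1) phi,
    forall x j, enorm x <= r -> pd j phi x = (j == k)%:R,
    forall x, 2^-1 <= enorm x -> phi x = 0 &
    exists M, forall j x, `|pd j phi x| <= M].
Proof.
(* The thirds of [[r, 1/2]]: the cutoff is 1 up to [r1 > r], hence on a neighbourhood of the closed
   [r]-ball, and 0 from [r3 < 1/2] on, which leaves the support compact in the open ball. *)
move=> /andP[r0 r2]; pose r1 : R := (2 * r + 2^-1) / 3;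
  pose r3 : R := (r + 2 * 2^-1) / 3.
have [rr1 r1r3 r32] : [/\ r < r1, r1 < r3 & r3 < 2^-1].
  by rewrite /r1 /r3; split; lra.
have r10 : 0 <= r1 by lra.
have r30 : 0 <= r3 by lra.
have sqle (x : V) s : 0 <= s -> (dotp x x <= s ^+ 2) = (enorm x <= s).
  by move=> s0; rewrite -sqr_enorm ler_pXn2r ?nnegrE ?enorm_ge0.
have sqge (x : V) s : 0 <= s -> (s ^+ 2 <= dotp x x) = (s <= enorm x).
  by move=> s0; rewrite -sqr_enorm ler_pXn2r ?nnegrE ?enorm_ge0.
have [|chi [schi chi1 chi0]] := @exists_cutoff R n (r1 ^+ 2) (r3 ^+ 2).
  by rewrite ltr_pXn2r ?nnegrE.
pose phi (x : V) := x 0 k * chi x.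
have sphi : smooth phi by exact: (smoothM (smooth_coord k) schi).
have phi0 (x : V) : r3 <= enorm x -> phi x = 0.
  by rewrite -sqge// => /chi0; rewrite /phi => ->; rewrite mulr0.
have suppphi : supp phi `<=` closed_eball 0 r3.
  rewrite [X in _ `<=` X]((closure_id _).1 (@closed_closed_eball R n 0 r3)).
  apply: closure_subset => x /= phix.
  rewrite /closed_eball/= subr0 leNgt; apply/negP => /ltW/phi0 p0.
  by rewrite p0 eqxx in phix.
exists phi; split => //.
- split => [s x||].
  + exact: smooth_iter_partial.
  + by apply: subclosed_compact suppphi;
    [exact: closed_closure|exact: compact_closed_eball].
  + by move=> x /suppphi; rewrite /closed_eball/eball/= => /le_lt_trans; apply.
- move=> x j xr.
  rewrite (@derive_eq_on_open phi (fun y => y 0 k) (eball 0 r1)).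
  + by rewrite derive_coord mxE eqxx eq_sym.
  + exact: open_eball.
  + by rewrite /eball/= subr0 (le_lt_trans xr).
  + by move=> y; rewrite /eball/= subr0 => /ltW; rewrite -sqle// => /chi1;
    rewrite /phi => ->; rewrite mulr1.
- by move=> x /(le_trans (ltW r32))/phi0.
- by apply: (@smooth_bounded_partial phi r3).
Qed.

Lemma is_derive_line (f : V -> R) (t : V) (s : R) : smooth f ->
  is_derive s 1 (fun u : R => f (u *: t)) ('D_t f (s *: t)).
Proof.
move=> sf; have : derivable f (s *: t) t by
  exact/diff_derivable/smooth_differentiable.
have E : (fun h : R => h^-1 *:
  (((fun u : R => f (u *: t)) \o shift s) (h *: 1) - f (s *: t)))
    = (fun h : R => h^-1 *: ((f \o shift (s *: t)) (h *: t) - f (s *: t))).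
  by apply/funext => h; rewrite /= scalerDl [h *: 1]mulr1.
by rewrite /derivable -E => d; apply: DeriveDef => //; rewrite /derive E.
Qed.

Lemma integral_partial_line (f : V -> R) (t : V) a b : smooth f -> a < b ->
  \int[lebesgue_measure]_(s in `[a, b]) (\sum_j t 0 j * pd j f (s *: t))
    = f (b *: t) - f (a *: t).
Proof.
move=> sf ab; have ct : continuous (fun s : R => s *: t).
  by move=> s; apply: cvgZr_tmp; exact: cvg_id.
have cline (g : V -> R) : smooth g -> continuous (fun s : R => g (s *: t)).
  move=> sg s; apply: (@continuous_comp R V R (fun s => s *: t) g);
    first exact: ct.
  exact: smooth_continuous.
rewrite /Rintegral (@continuous_FTC2 _ _ (fun s => f (s *: t)))//.
- apply: continuous_subspaceT => s.
  apply: (cline (fun x => \sum_j t 0 j * pd j f x)).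
  apply: smooth_sum => j; apply: (smoothM (smooth_cst _));
    exact: smooth_partial.
- split => [s _||].
  + by have [] := is_derive_line t s sf.
  + by apply: cvg_at_right_filter; exact: cline.
  + by apply: cvg_at_left_filter; exact: cline.
- move=> s _; rewrite derive1E -derive_partial//.
  by have [_ ->] := is_derive_line t s sf.
Qed.

End test_functions.

(** * Total mass of a competitor *)

Section total_mass.
Context {R : realType} {n : nat}.
Local Notation V := 'rV[R]_n.
Local Notation H1 := (@H1 R n).
Local Notation pd j f := ('D_(delta_mx 0 j) f).
Local Notation B := (@eball R n 0 2^-1).
Implicit Types (m : @rectdata R n) (b : 'rV[int]_n) (t : V).
Let T := caratheodory_type (H1_outer R n).

Lemma tensE (x y : V) i j : tens x y i j = x 0 i * y 0 j.
Proof. by rewrite /tens !mxE big_ord1 !mxE. Qed.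

Lemma densityE m x i j :
  density m x i j = (multiplicity m x 0 i)%:~R * tangent m x 0 j.
Proof. by rewrite /density tensE /intv !mxE. Qed.

Lemma Mdf_density_integrable m i j : Mdf B m ->
  H1.-integrable (carrier m : set T) (fun x => (density m x i j)%:E).
Proof.
move=> [_ [mE _] [tau1 mtau _] itheta _].
apply: (le_integrable mE _ _ (itheta i)).
  apply/measurable_EFinP.
  rewrite (_ : (fun x => _) = fun x => (multiplicity m x 0 i)%:~R * tangent m x
    0 j).
    apply: measurable_funM; last exact: mtau.
    by apply/measurable_EFinP; exact: measurable_int (itheta i).
  by apply/funext => x; rewrite densityE.
move=> x Ex; rewrite /= lee_fin densityE normrM ler_piMr//.
by rewrite -(tau1 x Ex) ler_coord_enorm.
Qed.

(** The point of the closed ball farthest from the origin, [c + r c/|c|], lies in [B], so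
    [|c| + r < 1/2]. If [c = 0] the unit vector [t] replaces the direction of [c]. *)
Lemma eball_in_centered_eball (c t : V) r : enorm t = 1 -> 0 < r ->
  closed_eball c r `<=` B ->
  exists2 r', 0 <= r' < 2^-1 & forall x, eball c r x -> enorm x <= r'.
Proof.
move=> t1 r0 cB; exists (enorm c + r); last first.
  move=> x /ltW cx; rewrite -(subrK c x) addrC.
  exact: le_trans (ler_enormD _ _) (lerD _ _).
rewrite addr_ge0 ?enorm_ge0 ?(ltW r0)//=.
have [u u1 cu] : exists2 u : V, enorm u = 1 & c = enorm c *: u.
  have [c0|c0] := eqVneq (enorm c) 0.
    by exists t; rewrite // c0 scale0r (enorm_eq0 c0).
  exists ((enorm c)^-1 *: c); last by rewrite scalerA divff ?scale1r.
  by rewrite enormZ ger0_norm ?invr_ge0 ?enorm_ge0// mulVf.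
have : B (c + r *: u).
  apply: cB; rewrite /closed_eball/= addrC addKr enormZ u1 mulr1.
  by rewrite ger0_norm// ltW.
rewrite /eball/= subr0 cu {1}(_ : enorm (_ *: u) = enorm c);
  last by rewrite -cu.
by rewrite -scalerDl enormZ u1 mulr1 ger0_norm ?addr_ge0 ?enorm_ge0 ?(ltW r0).
Qed.

Lemma borel_preimage_itvco (f : V -> R) (a c : R) : continuous f ->
  borel (f @^-1` `[a, c[).
Proof.
move=> cf; rewrite (_ : f @^-1` _ = f @^-1` [set y | y < c] `&` ~`
  (f @^-1` [set y | y < a])).
  have ob (e : R) : borel (f @^-1` [set y | y < e]).
    apply: borel_open; apply: open_comp; last exact: (@open_lt R).
    by move=> x _; exact: cf.
  apply: (@measurableI _ (g_sigma_algebraType [set U : set V | open U])).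
    exact: ob.
  by apply: (@measurableC _ (g_sigma_algebraType [set U : set V | open U]));
    exact: ob.
apply/seteqP; split => x /=; rewrite in_itv/=.
  by move=> /andP[h ->]; split => //; apply/negP; rewrite -leNgt.
by move=> [-> /negP]; rewrite -leNgt => ->.
Qed.

Lemma line_eball t : enorm t = 1 ->
  line t `&` B = (fun x => dotp x t) @^-1` `](- 2^-1), 2^-1[ `&` line t.
Proof.
move=> t1; apply/seteqP; split => [_ [[s _ <-]]|x [xB [s _ sx]]].
  rewrite /eball/= subr0 enormZ t1 mulr1 ltr_norml => sB; split;
    last by exists s.
  by rewrite /= in_itv/= dotp_unit_line.
move: xB; rewrite -sx /= in_itv/= dotp_unit_line// => sB; split;
  first by exists s.
by rewrite /eball/= subr0 enormZ t1 mulr1 ltr_norml.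
Qed.

Lemma line_integral t (f : V -> R) (M : R) : enorm t = 1 -> continuous f ->
  (forall x, `|f x| <= M) ->
  \int[H1]_(x in line t `&` B) f x =
  \int[lebesgue_measure]_(s in `[- 2^-1, 2^-1]) f (s *: t).
Proof.
move=> t1 cf fM; pose F (s : R) := f (s *: t).
have cF : continuous F.
  move=> s; apply: (@continuous_comp R V R (fun s => s *: t) f); last exact: cf.
  by apply: cvgZr_tmp; exact: cvg_id.
have mF : measurable_fun setT F by exact: continuous_measurable_fun.
rewrite line_eball//.
rewrite (@eq_Rintegral _ _ _ _ _ (fun x : T => F (dotp x t))); last first.
  move=> x; rewrite inE => -[_ [s _ <-]].
  by rewrite /F dotp_unit_line.
have fin : (lebesgue_measure (`](- 2^-1)%R, (2^-1)%R[%classic : set R) < +oo)%E.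
  by rewrite lebesgue_measure_itv/=; case: ifP => _; rewrite ltry.
have [_ E] := integral_H1_line t1 (measurable_itv `](- 2^-1), 2^-1[) fin mF
  (fun s => fM _).
rewrite [LHS](congr1 fine E).
have ibc : lebesgue_measure.-integrable `[- 2^-1, 2^-1] (EFin \o F).
  apply: continuous_compact_integrable; first exact: segment_compact.
  exact: continuous_subspaceT.
rewrite -Rintegral_itv_obnd_cbnd.
  rewrite -Rintegral_itv_bndo_bndc//.
  apply: integrableS ibc => //; exact: subset_itv_oo_cc.
apply: integrableS ibc => //; exact: subset_itv_oc_cc.
Qed.

(** As [f] vanishes on the inner ball, its level sets avoiding the value 0 stay outside that ball,
    where [m] and the straight line have the same measure. *)
Lemma rect_measure_levels m b t (c : V) (r : R) (f : V -> R) i j (M : R) : enorm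
  t = 1 -> Mdf B m ->
  (forall A, borel A -> A `<=` B `\` eball c r ->
    rect_measure m A = rect_measure (straight b t) A) ->
  continuous f -> (forall x, `|f x| <= M) -> (forall x, eball c r x -> f x = 0)
    ->
  \int[H1]_(x in carrier m) (f x * density m x i j) =
  \int[H1]_(x in line t `&` B) (f x * ((b 0 i)%:~R * t 0 j)).
Proof.
move=> t1 mM mb cf fM f0; have [mB [mE _] _ _ _] := mM.
have mline : measurable (line t `&` B : set T).
  apply: measurableI; first exact: (H1_measurable_line t1).
  by apply: H1_measurable_open; exact: open_eball.
have fin : (H1 (line t `&` B) < +oo)%E.
  rewrite line_eball// -(pushforward_H1_line t1)//.
  by rewrite lebesgue_measure_itv/=; case: ifP => _; rewrite ltry.
apply: (@eq_Rintegral_levels _ T R H1 _ _ (fun x => density m x i j) _ f M).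
- exact: mE.
- exact: mline.
- exact: Mdf_density_integrable.
- apply: measurable_bounded_integrable.
  + exact: mline.
  + exact: fin.
  + exact: measurable_cst.
  + exists `|(b 0 i)%:~R * t 0 j|; split; first exact: num_real.
    by move=> y /ltW ? ? _.
- exact: continuous_H1_measurable.
- exact: fM.
move=> a c' ac a0; pose A := B `&` f @^-1` `[a, c'[.
have bA : borel A.
  apply: (@measurableI _ (g_sigma_algebraType [set U : set V | open U])).
    by apply: borel_open; exact: open_eball.
  exact: borel_preimage_itvco.
have AB : A `<=` B `\` eball c r.
  move=> x [Bx fx]; split => // /f0 fx0; move: fx; rewrite /= fx0.
  by rewrite (negbTE a0).
have -> : carrier m `&` f @^-1` `[a, c'[ = carrier m `&` A.
  by rewrite /A setIA; congr (_ `&` _); apply/esym/setIidl.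
rewrite -setIA -/A.
have := congr1 (fun X : 'M[R]_n => X i j) (mb A bA AB).
rewrite !mxE => ->; apply: eq_Rintegral => x _.
by rewrite densityE.
Qed.

Lemma total_mass m b t i k : enorm t = 1 -> Mdf B m ->
  straight_near_boundary b t m ->
  \int[H1]_(x in carrier m) density m x i k = (b 0 i)%:~R * t 0 k.
Proof.
move=> t1 mM [c [r [r0 cB mb]]].
have [r' r'2 cr'] := eball_in_centered_eball t1 r0 cB.
have [phi [sphi tphi phi1 phi0 [M HM]]] := exists_test_function k r'2.
have [mB [mE _] _ _ divm] := mM.
pose psi j (x : V) := pd j phi x - (j == k)%:R.
have cpsi j : continuous (psi j).
  by move=> x; exact: (cvgB (@smooth_continuous R n _ (smooth_partial j sphi) x)
    (cvg_cst _)).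
have psiM j x : `|psi j x| <= M + 1.
  by rewrite (le_trans (ler_normB _ _))// lerD ?HM//; case: (_ == _);
    rewrite ?normr1 ?normr0.
have psi0 j x : eball c r x -> psi j x = 0.
  by move=> /cr' xr; rewrite /psi phi1// subrr.
have ipsi j := rect_measure_levels i j t1 mM mb (cpsi j) (psiM j) (psi0 j).
have idens j := Mdf_density_integrable i j mM.
have ipd j : rect_integral m i j (pd j phi) =
    \int[H1]_(x in carrier m) (psi j x * density m x i j) +
    (j == k)%:R * \int[H1]_(x in carrier m) density m x i j.
  rewrite /rect_integral -RintegralZl//; last exact: idens.
  rewrite -RintegralD.
  - by apply: eq_Rintegral => x _; rewrite -mulrDl subrK.
  - exact: mE.
  - apply: (@integrable_bounded_mul _ T R H1 _ _ _ (M + 1)).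
    + exact: mE.
    + exact: idens.
    + by apply: measurable_funTS; exact: continuous_H1_measurable.
    + by move=> x _; exact: psiM.
  - rewrite (_ : _ \o _ = fun x =>
    (((j == k)%:R)%:E * (density m x i j)%:E)%E)//.
    by apply: integrableZl; [exact: mE|exact: idens].
have := divm phi tphi i.
under eq_bigr => j _ do rewrite ipd ipsi.
rewrite big_split/= [X in _ + X](bigD1 k)//= eqxx mul1r [X in _ + (_ + X)]big1
  ?addr0; last first.
  by move=> j /negbTE ->; rewrite mul0r.
(* The mass is minus the sum of the integrals of [psi j], and these now live on the straight
   line. *)
move/eqP; rewrite addrC addr_eq0 => /eqP ->.
pose C : R := (b 0 i)%:~R.
have ict (g : V -> R) : continuous g ->
    lebesgue_measure.-integrable `[- 2^-1, 2^-1]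
      (EFin \o (fun s : R => g (s *: t))).
  move=> cg; apply: continuous_compact_integrable; first exact: segment_compact.
  apply: continuous_subspaceT => s.
  apply: (@continuous_comp R V R (fun s => s *: t) g); last exact: cg.
  by apply: cvgZr_tmp; exact: cvg_id.
have -> : \sum_j \int[H1]_(x in line t `&` B) (psi j x * ((b 0 i)%:~R * t 0 j))
  =
    \sum_j \int[lebesgue_measure]_(s in `[- 2^-1, 2^-1])
      (C * (t 0 j * pd j phi (s *: t) - t 0 j * (j == k)%:R)).
  apply: eq_bigr => j _.
  rewrite (@line_integral _ _ ((M + 1) * `|(b 0 i)%:~R * t 0 j|))//.
  - by apply: eq_Rintegral => s _; rewrite /psi -/C; ring.
  - move=> x; exact: (cvgM (cpsi j x) (cvg_cst _)).
  - by move=> x; rewrite normrM; apply: ler_wpM2r.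
rewrite -Rintegral_sum//; last first.
  move=> j; apply: (ict (fun x => C *
    (t 0 j * pd j phi x - t 0 j * (j == k)%:R))).
  exact: smooth_continuous (smoothM (smooth_cst C)
    (smoothD (smoothM (smooth_cst _) (smooth_partial j sphi)) (smooth_cst _))).
have -> : \int[lebesgue_measure]_(s in `[- 2^-1, 2^-1])
     (\sum_j C * (t 0 j * pd j phi (s *: t) - t 0 j * (j == k)%:R)) =
   C * (\int[lebesgue_measure]_(s in `[- 2^-1, 2^-1])
     (\sum_j t 0 j * pd j phi (s *: t)) - t 0 k).
  (* The chord of [B] along [t] has length 1. *)
  have cst_k : \int[lebesgue_measure]_(s in (`[(- 2^-1 : R), 2^-1]%classic))
    (t 0 k) = t 0 k.
    rewrite Rintegral_cst//.
    rewrite [X in fine X](_ : _ = lebesgue_measure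
      (`[(- 2^-1 : R), 2^-1]%classic : set R))//.
    rewrite lebesgue_measure_itv/= lte_fin ifT; last by lra.
    by rewrite /= opprK (_ : 2^-1 + 2^-1 = 1) ?mulr1//; lra.
  have sg : smooth (fun x : V => \sum_j t 0 j * pd j phi x).
    by apply: smooth_sum => j; exact:
      (smoothM (smooth_cst _) (smooth_partial j sphi)).
  transitivity (\int[lebesgue_measure]_(s in `[- 2^-1, 2^-1])
      (C * (\sum_j t 0 j * pd j phi (s *: t) - t 0 k))).
    apply: eq_Rintegral => s _; rewrite -mulr_sumr sumrB; congr (_ * (_ - _)).
    rewrite (bigD1 k)//= eqxx mulr1 big1 ?addr0// => j /negbTE ->.
    by rewrite mulr0.
  rewrite RintegralZl//; last first.
    exact: (ict _ (@smooth_continuous R n _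
      (smoothD sg (smooth_cst (- t 0 k))))).
  rewrite RintegralB//; last 2 first.
  - exact: (ict _ (@smooth_continuous R n _ sg)).
  - exact: (ict _ (@smooth_continuous R n _ (smooth_cst (t 0 k)))).
  by rewrite cst_k.
rewrite integral_partial_line//; last by lra.
rewrite !phi0; last 2 first.
- by rewrite enormZ t1 mulr1 normrN ger0_norm// invr_ge0.
- by rewrite enormZ t1 mulr1 ger0_norm// invr_ge0.
by rewrite subrr sub0r mulrN opprK.
Qed.

End total_mass.

(** * Existence of the minimum *)

Section minimum.
Context {R : realType} {n : nat}.
Variable eta : R.
Hypothesis eta01 : 0 <= eta <= 1.
Local Notation V := 'rV[R]_n.
Implicit Types (a b : 'rV[int]_n) (t v : V).
Local Notation psi_e := (homogeneous_ext (quadratic_psi eta)).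

Lemma homogeneous_ext_ge0 a v : 0 <= psi_e a v.
Proof.
case/andP: eta01 => eta0 _.
by apply: mulr_ge0; [exact: enorm_ge0|exact: quadratic_psi_ge0].
Qed.

Lemma homogeneous_extv0 a : psi_e a 0 = 0.
Proof. by rewrite /homogeneous_ext enorm0 mul0r. Qed.

Lemma homogeneous_ext0 v : psi_e 0 v = 0.
Proof.
rewrite /homogeneous_ext /quadratic_psi (_ : intv 0 = 0).
  by rewrite enorm0 dotp0l expr0n/= mulr0 addr0 mulr0.
by apply/rowP => i; rewrite /intv !mxE.
Qed.

Lemma quadratic_psi_le a v : enorm v <= 1 ->
  quadratic_psi eta a v <= 2 * enorm (intv a : V) ^+ 2.
Proof.
case/andP: eta01 => eta0 eta1 v1.
have h : dotp (intv a) v ^+ 2 <= enorm (intv a : V) ^+ 2.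
  rewrite -[X in X <= _]real_normK ?num_real// ler_pXn2r ?nnegrE ?enorm_ge0//.
  by rewrite (le_trans (ler_norm_dotp _ _))// ler_piMr ?enorm_ge0.
have : eta * dotp (intv a) v ^+ 2 <= dotp (intv a) v ^+ 2 by rewrite ler_piMl
  ?sqr_ge0.
rewrite /quadratic_psi; lra.
Qed.

Lemma enorm_normalize_le1 v : enorm ((enorm v)^-1 *: v) <= 1.
Proof.
rewrite enormZ ger0_norm ?invr_ge0 ?enorm_ge0//.
have [->|v0] := eqVneq (enorm v) 0; first by rewrite mulr0.
by rewrite mulVf.
Qed.

Lemma homogeneous_ext_continuous a : continuous (psi_e a).
Proof.
have cn : continuous (fun v : V => enorm v).
  by apply: (@continuous_enorm _ _ V id) => z; exact: cvg_id.
move=> v; have [v0|v0] := eqVneq v 0.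
  (* At the origin the direction [v/|v|] has no limit, but it stays in the unit ball, so [psi_e a v]
     is at most [2 |a|^2 |v|]. *)
  rewrite v0; have C0 : 0 <= 2 * enorm (intv a : V) ^+ 2 by rewrite mulr_ge0
    ?sqr_ge0.
  rewrite /continuous_at homogeneous_extv0.
  apply: (@squeeze_cvgr V (nbhs (0 : V)) _ R (cst 0)
    (fun v => enorm v * (2 * enorm (intv a : V) ^+ 2))).
  - near=> x; rewrite /= homogeneous_ext_ge0/=.
    by apply: ler_wpM2l; [exact: enorm_ge0|exact/quadratic_psi_le/enorm_normalize_le1].
  - exact: cvg_cst.
  - have E : enorm (0 : V) * (2 * enorm (intv a : V) ^+ 2) = 0 by rewrite enorm0
    mul0r.
    by rewrite -[X in _ --> X]E; apply: cvgM; [exact: cn|exact: cvg_cst].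
have en0 : enorm v != 0 by apply: contra_neq v0; exact: enorm_eq0.
have cd : dotp (intv a) ((enorm x)^-1 *: x) @[x --> v] --> dotp (intv a)
  ((enorm v)^-1 *: v).
  have -> : (fun x : V => dotp (intv a) ((enorm x)^-1 *: x)) =
      fun x => (enorm x)^-1 * dotp (intv a) x.
    by apply/funext => x; rewrite dotpZr.
  have cav : continuous (fun x : V => dotp (intv a) x).
    by apply: (@continuous_dotp _ _ V (cst (intv a)) id) => z;
      [exact: cst_continuous|exact: cvg_id].
  by rewrite dotpZr; exact: (cvgM (cvgV en0 (cn v)) (cav v)).
exact: (cvgM (cn v) (cvgD (cvg_cst _) (cvgM (cvg_cst _) (cvgM cd cd)))).
Unshelve. all: by end_near. Qed.

Lemma intv_norm_ge1 a : a != 0 -> 1 <= enorm (intv a : V) ^+ 2.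
Proof.
move=> /rV0Pn[i ai]; apply: (@le_trans _ _ (`|(intv a : V) 0 i| ^+ 2)).
  rewrite /intv mxE -intr_norm -[1]/(1%:~R) -rmorphXn/= ler_int.
  by rewrite -gtz0_ge1 exprn_gt0// normr_gt0.
by rewrite ler_pXn2r ?nnegrE ?enorm_ge0// ler_coord_enorm.
Qed.

(** Coercivity from integrality: a nonzero integer vector has [|a| >= 1]. It confines decompositions
    of bounded energy to a compact set. *)
Lemma homogeneous_ext_ge a v : a != 0 -> enorm v <= psi_e a v.
Proof.
move=> a0; rewrite /homogeneous_ext ler_peMr ?enorm_ge0//.
case/andP: eta01 => eta0 _.
by apply: ler_wpDr; [apply: mulr_ge0 => //;
  exact: sqr_ge0|exact: intv_norm_ge1].
Qed.

Section box.
Variables (k : nat) (b : 'rV[int]_n) (t : V).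
Local Notation I := ('rV['I_(k.*2.+1)]_n).
Local Notation energy := (decomposition_energy (quadratic_psi eta)).

Lemma tens_sumE (T : I -> V) i j :
  (\sum_x tens (intv (box_point x)) (T x)) i j =
  \sum_x (box_point x 0 i)%:~R * T x 0 j.
Proof. by rewrite summxE; apply: eq_bigr => x _; rewrite tensE /intv mxE. Qed.

Lemma box_splitting_decomposition m : @box_splitting R n k m b ->
  decompositions k b t (fun x => (m x)%:R *: t).
Proof.
move=> [mb _ _]; rewrite /decompositions/=; apply/matrixP => i j.
rewrite tens_sumE tensE /intv mxE -mb summxE rmorph_sum/= mulr_suml.
by apply: eq_bigr => x _; rewrite !mxE intrM mulrCA mulrA.
Qed.

Lemma exists_minimum T0 : decompositions k b t T0 ->
  exists m, is_minimum [set energy T | T in decompositions k b t] m.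
Proof.
(* The component at the zero point is free in the constraint and costs nothing, so it could escape
   to infinity; [kill] sets it to 0. *)
move=> dT0; pose kill (T : I -> V) : I -> V := fun x => if box_point x == 0 then
  0 else T x.
have killE T : energy (kill T) = energy T.
  apply: eq_bigr => x _; rewrite /kill; case: eqP => // ->.
  by rewrite !homogeneous_ext0.
have killD T : decompositions k b t T -> decompositions k b t (kill T).
  rewrite /decompositions/= => <-; apply: eq_bigr => x _; rewrite /kill;
    case: eqP => // ->.
  by apply/matrixP => i j; rewrite !tensE /intv !mxE !mul0r.
have kill_le T x : enorm (kill T x) <= energy T.
  have E0 : 0 <= energy T by apply: sumr_ge0 => ? _; exact: homogeneous_ext_ge0.
  rewrite /kill; case: eqP => [_|/eqP x0]; first by rewrite enorm0.
  apply: (le_trans (homogeneous_ext_ge _ x0)).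
  by rewrite /decomposition_energy (bigD1 x)//= lerDl sumr_ge0// => ? _;
    exact: homogeneous_ext_ge0.
pose W := prod_topology (fun _ : I => V).
pose K : set W := [set T : W | forall x, closed_eball 0 (energy T0) (T x)].
have cK : compact K.
  by apply: (@tychonoff I (fun=> V) (fun=> closed_eball 0 (energy T0))) => x;
    exact: compact_closed_eball.
have cproj (x : I) : continuous (fun T : W => T x) by exact:
  (@proj_continuous I (fun=> V) x).
have cD : closed (decompositions k b t : set W).
  have -> : decompositions k b t = \bigcap_(ij in [set: 'I_n * 'I_n])
      [set T : W | \sum_x (box_point x 0 ij.1)%:~R * (T x) 0 ij.2 = tens
        (intv b) t ij.1 ij.2].
    apply/seteqP; split => T.
      by move=> dT [i j] _ /=; rewrite -tens_sumE dT.
    by move=> h; apply/matrixP => i j; rewrite tens_sumE; exact: (h (i, j)).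
  apply: closed_bigI => -[i j] _ /=.
  apply: (@preimage_closed W R (fun T => \sum_x (box_point x 0 i)%:~R * (T x) 0
    j) [set tens (intv b) t i j]); last exact: closed_eq.
  move=> T _; apply: (@continuous_big R _ +%R 0 xpredT) => [|x _ T'].
    exact: add_continuous.
  have cx : continuous (fun T : W => (T x) 0 j).
    move=> U; apply: (@continuous_comp W V R (fun T => T x) (fun v => v 0 j)).
      exact: cproj.
    exact: coord_continuous.
  exact: (cvgM (cvg_cst _) (cx T')).
have cE : continuous (fun T : W => energy T).
  apply: (@continuous_big R _ +%R 0 xpredT) => [|x _ T'].
    exact: add_continuous.
  by apply: (@continuous_comp W V R (fun T => T x) (psi_e (box_point x)));
    [exact: cproj|exact: homogeneous_ext_continuous].
have K0 : (K `&` decompositions k b t) (kill T0).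
  by split; [move=> x; rewrite /closed_eball/= subr0 kill_le|exact: killD].
have [|||T /set_mem[_ dT] minT] := @compact_EVT_min W R (fun T : W => energy T)
  (K `&` decompositions k b t).
- by exists (kill T0).
- exact: compact_closedI.
- exact: continuous_subspaceT.
exists (energy T); split; first by exists T.
move=> _ [T' dT' <-]; have [le0|/ltW gt0] := leP (energy T') (energy T0).
  rewrite -(killE T'); apply: minT; rewrite inE; split; last exact: killD.
  by move=> x; rewrite /closed_eball/= subr0 (le_trans (kill_le T' x)).
(* A decomposition with more energy than [T0] is beaten by [kill T0], which lies in [K]. *)
by apply: le_trans gt0; rewrite -(killE T0); apply: minT; rewrite inE.
Qed.

End box.
End minimum.

(** * Lower bound for the energy *)

(** Since [Z^n] is countable, a preimage under [g \o theta] is a countable union of fibres of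
    [theta], each cut out by finitely many coordinate conditions. This covers the box
    multiplicities, which are obtained by choice and have no formula. *)
Lemma measurable_fun_discrete_comp d (T : measurableType d) (R : realType)
  (n : nat)
    (E : set T) (theta : T -> 'rV[int]_n) (g : 'rV[int]_n -> R) :
  (forall i, measurable_fun E (fun x => (theta x 0 i)%:~R : R)) ->
  measurable_fun E (fun x => g (theta x)).
Proof.
move=> mtheta mE Y mY.
pose F (z : 'rV[int]_n) := E `&`
  \bigcap_(i in [set: 'I_n]) (E `&` (fun x => (theta x 0 i)%:~R : R) @^-1`
    [set (z 0 i)%:~R]).
have mF z : measurable (F z).
  apply: measurableI => //; apply: fin_bigcap_measurable => // i _.
  exact: mtheta.
have FE z x : F z x <-> E x /\ theta x = z.
  split => [[Ex Fx]|[Ex <-]]; last by split.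
  split => //; apply/rowP => i; have [_ /= /eqP] := Fx i Logic.I.
  by rewrite eqr_int => /eqP.
rewrite (_ : _ `&` _ = \bigcup_z (if g z \in Y then F z else set0)).
  apply: countable_bigcupT_measurable; first exact: countableP.
  by move=> z; case: ifP.
apply/seteqP; split => [x [Ex /= Yx]|x [z _]].
  by exists (theta x) => //; rewrite mem_set//; apply/FE.
by case: ifPn => // /set_mem Yz /FE[Ex xz]; split => //=; rewrite xz.
Qed.

Section energy_bound.
Context {R : realType} {n : nat}.
Local Notation V := 'rV[R]_n.
Local Notation H1 := (@H1 R n).
Local Notation B := (@eball R n 0 2^-1).
Variable eta : R.
Hypothesis eta01 : 0 <= eta <= 1.
Local Notation psi := (quadratic_psi eta).
Let T := caratheodory_type (H1_outer R n).
Implicit Types (m : @rectdata R n) (b : 'rV[int]_n) (t : V).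

(* Jensen's inequality, by integrating a supporting linear functional. *)
Lemma homogeneous_ext_Rintegral (a : 'rV[int]_n) (E : set T) (c : V -> R)
  (tau : V -> V) :
  measurable E -> (forall x, E x -> enorm (tau x) = 1) -> (forall x, 0 <= c x)
    ->
  (forall j, H1.-integrable E (fun x => (c x * tau x 0 j)%:E)) ->
  H1.-integrable E (fun x => (c x * psi a (tau x))%:E) ->
  homogeneous_ext psi a (\row_j \int[H1]_(x in E) (c x * tau x 0 j)) <=
    \int[H1]_(x in E) (c x * psi a (tau x)).
Proof.
move=> mE tau1 c0 ictau icpsi; case/andP: (eta01) => eta0 _.
set w := \row_j _; have [w0|w0] := eqVneq w 0.
  rewrite w0 homogeneous_extv0; apply: Rintegral_ge0 => x _.
  by apply: mulr_ge0; [exact: c0|exact: quadratic_psi_ge0].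
have ew0 : enorm w != 0 by apply: contra_neq w0; exact: enorm_eq0.
have [u [u1 wu uw]] : exists u,
  [/\ enorm u = 1, (enorm w)^-1 *: w = u & w = enorm w *: u].
  exists ((enorm w)^-1 *: w); split => //.
    by rewrite enormZ ger0_norm ?invr_ge0 ?enorm_ge0// mulVf.
  by rewrite scalerA mulfV// scale1r.
have uu : dotp u u = 1 by rewrite -sqr_enorm u1 expr1n.
(* The gradient at [u] of the one-homogeneous extension for [a]; by Euler's identity, its product
   with [w] is the value at [w]. *)
pose l : V := (enorm (intv a : V) ^+ 2 - eta * dotp (intv a) u ^+ 2) *: u
  + (2 * eta * dotp (intv a) u) *: intv a.
have -> : homogeneous_ext psi a w = dotp l w.
  rewrite /homogeneous_ext wu {2}uw dotpZr; congr (_ * _).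
  rewrite /l dotpDl !dotpZl uu /quadratic_psi; ring.
have il j : H1.-integrable E (EFin \o (fun x => l 0 j * (c x * tau x 0 j))).
  rewrite (_ : _ \o _ = fun x => ((l 0 j)%:E * (c x * tau x 0 j)%:E)%E)//.
  by apply: integrableZl; [exact: mE|exact: ictau].
have -> : dotp l w = \int[H1]_(x in E) (\sum_j l 0 j * (c x * tau x 0 j)).
  rewrite Rintegral_sum; [|exact: mE|exact: il].
  by apply: eq_bigr => j _; rewrite [w 0 j]mxE; apply/esym/RintegralZl;
    [exact: mE|exact: ictau].
apply: le_Rintegral.
- exact: mE.
- rewrite (_ : _ \o _ = fun x => (\sum_j (l 0 j * (c x * tau x 0 j))%:E)%E).
    by apply: integrable_sum; [exact: mE|move=> j _; exact: il].
  by apply/funext => x /=; rewrite sumEFin.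
- exact: icpsi.
move=> x Ex.
rewrite (_ : \sum_j _ = c x * dotp l (tau x)); last first.
  by rewrite mulr_sumr; apply: eq_bigr => j _; ring.
apply: (ler_wpM2l (c0 x)); rewrite /l dotpDl !dotpZl.
exact: (quadratic_psi_subgradient _ eta01 u1 (tau1 x Ex)).
Qed.

Lemma energy_lower_bound k b t m : enorm t = 1 ->
  (forall b', exists c, @box_splitting R n k c b') ->
  Mdf B m -> straight_near_boundary b t m ->
  exists2 D, decompositions k b t D &
    ((decomposition_energy psi D)%:E <= line_energy psi m)%E.
Proof.
move=> t1 splits mM mb; have [c Hc] := choice splits.
have [mB [mE _] [tau1 mtau _] itheta _] := mM.
case/andP: (eta01) => eta0 _.
set E : set T := carrier m; pose theta := multiplicity m; pose tau := tangent m.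
have mtheta i : measurable_fun (E : set T) (fun x => (theta x 0 i)%:~R : R).
  by apply/measurable_EFinP; exact: measurable_int (itheta i).
have mg (g : 'rV[int]_n -> R) : measurable_fun (E : set T)
  (fun x : T => g (theta x)).
  exact: measurable_fun_discrete_comp.
have mpsi (g : 'rV[int]_n -> 'rV[int]_n) :
    measurable_fun (E : set T) (fun x : T => psi (g (theta x)) (tau x)).
  apply: measurable_funD; first exact:
    (mg (fun z => enorm (intv (g z) : V) ^+ 2)).
  apply: measurable_funM; first exact: measurable_cst.
  apply: measurable_funX; apply: measurable_sum => j.
  apply: measurable_funM; last exact: mtau.
  exact: (mg (fun z => (intv (g z) : V) 0 j)).
have psi0 x : 0 <= psi (theta x) (tau x) by exact: quadratic_psi_ge0.
(* With infinite energy the integrals defining [D] may fail to converge; any decomposition then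
   does, such as the one given by splitting [b] itself. *)
have [Eoo|Efin] := eqVneq (line_energy psi m) +oo%E.
  exists (fun x => (c b x)%:R *: t); last by rewrite Eoo leey.
  exact: (box_splitting_decomposition t (Hc b)).
have ipsi : H1.-integrable E (EFin \o (fun x : T => psi (theta x) (tau x))).
  apply/integrableP; split; first by apply/measurable_EFinP; exact: (mpsi id).
  rewrite (eq_integral (fun x : T => (psi (theta x) (tau x))%:E));
    first by rewrite ltey.
  by move=> x _; rewrite /= ger0_norm.
have psi_box y x : E y ->
    (c (theta y) x)%:R * psi (box_point x) (tau y) <= psi (theta y) (tau y).
  move=> Ey; have [_ _ h] := Hc (theta y).
  apply: le_trans (h eta (tau y) eta01 (tau1 y Ey)).
  rewrite (bigD1 x)//= lerDl sumr_ge0// => z _.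
  by apply: mulr_ge0 => //; exact: quadratic_psi_ge0.
have icpsi x : H1.-integrable E
    (EFin \o (fun y : T => (c (theta y) x)%:R * psi (box_point x) (tau y))).
  apply: (le_integrable mE _ _ ipsi).
    apply/measurable_EFinP; apply: measurable_funM;
      last exact: (mpsi (fun=> box_point x)).
    exact: (mg (fun z => (c z x)%:R)).
  move=> y Ey; rewrite /= lee_fin !ger0_norm//; first exact: psi_box.
  by apply: mulr_ge0 => //; exact: quadratic_psi_ge0.
(* The energy dominates: at a nonzero box point [psi >= 1 >= |tau_j|], and at the zero point the
   multiplicity is 0. *)
have ictau x j : H1.-integrable E
  (EFin \o (fun y : T => (c (theta y) x)%:R * tau y 0 j)).
  apply: (le_integrable mE _ _ ipsi).
    apply/measurable_EFinP; apply: measurable_funM; last exact: mtau.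
    exact: (mg (fun z => (c z x)%:R)).
  move=> y Ey; rewrite /= lee_fin [leRHS]ger0_norm// normrM normr_nat.
  have [x0|x0] := eqVneq (box_point x) 0.
    by have [_ h0 _] := Hc (theta y); rewrite (h0 _ x0) mul0r.
  apply: le_trans (psi_box y x Ey); apply: ler_wpM2l => //.
  apply: (@le_trans _ _ 1); first by rewrite -(tau1 y Ey) ler_coord_enorm.
  by apply: ler_wpDr; [apply: mulr_ge0 => //;
    exact: sqr_ge0|exact: intv_norm_ge1].
pose D x : V := \row_j \int[H1]_(y in E) ((c (theta y) x)%:R * tau y 0 j).
exists D.
  rewrite /decompositions/=; apply/matrixP => i j;
    rewrite tens_sumE tensE /intv mxE.
  rewrite -(total_mass i j t1 mM mb).
  (* Pointwise the box points weighted by [c (theta y)] sum to [theta y], so the constraint on [D]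
     is the total mass identity. *)
  transitivity (\int[H1]_(y in E)
    (\sum_x (box_point x 0 i)%:~R * ((c (theta y) x)%:R * tau y 0 j))).
    rewrite Rintegral_sum; [|exact: mE|].
      apply: eq_bigr => x _; rewrite [D x 0 j]mxE.
      by apply/esym/RintegralZl; [exact: mE|exact: ictau].
    move=> x; rewrite (_ : _ \o _ = fun y : T =>
      (((box_point x 0 i)%:~R)%:E * ((c (theta y) x)%:R * tau y 0 j)%:E)%E)//.
    by apply: integrableZl; [exact: mE|exact: ictau].
  apply: eq_Rintegral => y _; rewrite densityE -/theta -/tau.
  have [h _ _] := Hc (theta y).
  rewrite -[in RHS]h summxE rmorph_sum/= mulr_suml.
  apply: eq_bigr => x _; rewrite [in RHS]mxE intrM -pmulrn; ring.
have -> : line_energy psi m = (\int[H1]_(y in E) psi (theta y) (tau y))%:E.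
  by rewrite /Rintegral fineK//; exact: (integrable_fin_num mE ipsi).
rewrite lee_fin.
apply: (@le_trans _ _ (\sum_x \int[H1]_(y in E)
  ((c (theta y) x)%:R * psi (box_point x) (tau y)))).
  apply: ler_sum => x _; apply: (@homogeneous_ext_Rintegral _ _
    (fun y : T => (c (theta y) x)%:R)).
  - exact: mE.
  - exact: tau1.
  - by move=> y; exact: ler0n.
  - by move=> j; exact: ictau.
  - exact: icpsi.
rewrite -Rintegral_sum; [|exact: mE|exact: icpsi].
apply: le_Rintegral.
- exact: mE.
- rewrite (_ : _ \o _ = fun y : T =>
  (\sum_x ((c (theta y) x)%:R * psi (box_point x) (tau y))%:E)%E).
    by apply: integrable_sum; [exact: mE|move=> x _; exact: icpsi].
  by apply/funext => y /=; rewrite sumEFin.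
- exact: ipsi.
- by move=> y Ey; have [_ _] := Hc (theta y); apply => //; exact: tau1.
Qed.

End energy_bound.

Theorem proposition4p1 (R : realType) (n : nat) (eta : R)
    (eta01 : 0 <= eta <= 1) :
  ((n <= 9)%N ->
    forall (b : 'rV[int]_n) (t : 'rV[R]_n), enorm t = 1 ->
      exists2 m : R,
        is_minimum [set decomposition_energy (quadratic_psi eta) T
                   | T in decompositions 1 b t]%classic m &
        (m%:E <= H1_elliptic_envelope (quadratic_psi eta) b t)%E) /\
  ((10 <= n)%N ->
    forall (b : 'rV[int]_n) (t : 'rV[R]_n), enorm t = 1 ->
      exists2 m : R,
        is_minimum [set decomposition_energy (quadratic_psi eta) T
                   | T in decompositions (2 * n) b t]%classic m &
        (m%:E <= H1_elliptic_envelope (quadratic_psi eta) b t)%E).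
Proof.
have bound k (b : 'rV[int]_n) (t : 'rV[R]_n) : enorm t = 1 ->
    (forall b', exists c, @box_splitting R n k c b') ->
    exists2 m : R,
      is_minimum [set decomposition_energy (quadratic_psi eta) T
                 | T in decompositions k b t]%classic m &
      (m%:E <= H1_elliptic_envelope (quadratic_psi eta) b t)%E.
  move=> t1 splits; have [c Hc] := splits b.
  have [m mmin] := exists_minimum eta01 (box_splitting_decomposition t Hc).
  exists m => //; apply: le_ereal_inf_tmp => _ [mu [muM mub] <-].
  have [D dD] := energy_lower_bound eta01 t1 splits muM mub.
  by apply: le_trans; rewrite lee_fin; apply: mmin.2; exists D.
split => [n9|_] b t t1; apply: bound => // b';
  apply: exists_box_splitting => b''.
  exact: splitting_le9.
exact: splitting_half.
Qed.
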